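(* Let $\Gamma$ be a finite subgroup of $\mathbf{SL}_3(\mathbb{C})$ with character table $T_\Gamma$, natural character $\chi$, and conjugacy class representatives $g_0,\dots,g_l$. Then $T_\Gamma$ is invertible, the matrices $\Lambda^{(1)}:=T_\Gamma^{-1}A^{(1)}T_\Gamma$ and $\Lambda^{(2)}:=T_\Gamma^{-1}A^{(2)}T_\Gamma$ are diagonal with $\Lambda^{(1)}_{jj}=\overline{\chi(g_j)}$ and $\Lambda^{(2)}_{jj}=\chi(g_j)$ for $0\le j\le l$, and $$P_\Gamma(t,u)=T_\Gamma\,\Delta(t,u)\,T_\Gamma^{-1}v_{0,0},$$ where $\Delta(t,u)$ is the diagonal $(l+1)\times(l+1)$ matrix over $\mathbb{C}(t,u)$ with diagonal entries $\Delta(t,u)_{jj}=f(\overline{\chi(g_j)},\chi(g_j))$, with $$f(d_1,d_2)=\frac{1-tu}{(1-td_1+t^2d_2-t^3)(1-ud_2+u^2d_1-u^3)}\qquad (d_1,d_2\in\mathbb{C}).$$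
   Context: $\gamma_0,\dots,\gamma_l$ are representatives of the equivalence classes of irreducible finite-dimensional complex representations of $\Gamma$, with $\gamma_0$ trivial and $\chi_i$ the character of $\gamma_i$. $C_0,\dots,C_l$ are the conjugacy classes of $\Gamma$ and $g_j\in C_j$; the character table is the matrix $(T_\Gamma)_{i,j}=\chi_i(g_j)$. $\gamma$ is the natural representation of $\Gamma$ on $\mathbb{C}^3$, $\chi$ its character, $\gamma^*$ its contragredient. The matrices $A^{(1)}=(a^{(1)}_{ij})$, $A^{(2)}=(a^{(2)}_{ij})$, $0\le i,j\le l$, are defined by $\gamma_j\otimes\gamma=\bigoplus_{i}a^{(1)}_{ij}\gamma_i$ and $\gamma_j\otimes\gamma^*=\bigoplus_i a^{(2)}_{ij}\gamma_i$. Let $\varpi_1,\varpi_2$ be the fundamental weights of $\mathfrak{sl}_3(\mathbb{C})$ (with $\varpi_1$ the highest weight of the natural representation $\mathbb{C}^3$), and let $\pi_{m,n}$ be the irreducible representation of $\mathbf{SL}_3(\mathbb{C})$ of highest weight $m\varpi_1+n\varpi_2$, $(m,n)\in\mathbb{N}^2$ ($0\in\mathbb{N}$). Write $\pi_{m,n}|_\Gamma=\bigoplus_{i=0}^l m_i(m,n)\gamma_i$, $v_{m,n}=\sum_{i=0}^l m_i(m,n)e_i\in\mathbb{C}^{l+1}$ with $(e_0,\dots,e_l)$ the canonical basis (so $v_{0,0}=e_0$), and $P_\Gamma(t,u)=\sum_{m,n\ge0}v_{m,n}t^mu^n\in(\mathbb{C}[[t,u]])^{l+1}$. Rational functions whose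 denominator has nonzero constant term are identified with their power series expansions. *)

(* Defs.v *)
From HB Require Import structures.
From mathcomp Require Import all_boot all_order all_algebra all_fingroup.
From mathcomp Require Import mxrepresentation character.
From mathcomp Require Import finmap mpoly complex reals.
Set Implicit Arguments.
Unset Strict Implicit.
Unset Printing Implicit Defensive.
Import Order.TTheory GRing.Theory Num.Theory.
Local Open Scope ring_scope.

Record SL3 (F : fieldType) := MkSL3 {
  SL3_mx :> 'M[F]_3;
  _ : \det SL3_mx == 1
}.

Section SL3Group.
Variable F : fieldType.
Implicit Types A B C : SL3 F.

HB.instance Definition _ := [isSub for @SL3_mx F].
HB.instance Definition _ := [Choice of SL3 F by <:].

Lemma SL3_det A : \det A = 1.
Proof. exact/eqP/(valP A). Qed.

Lemma SL3_unitmx A : (A : 'M_3) \in unitmx.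
Proof. by rewrite unitmxE SL3_det unitr1. Qed.

Fact SL3_one_subproof : \det (1%:M : 'M[F]_3) == 1.
Proof. by rewrite det1. Qed.

Fact SL3_mul_subproof A B : \det (A *m B) == 1.
Proof. by rewrite det_mulmx !SL3_det mulr1. Qed.

Fact SL3_inv_subproof A : \det (invmx A) == 1.
Proof. by rewrite det_inv SL3_det invr1. Qed.

Definition SL3_one : SL3 F := MkSL3 SL3_one_subproof.
Definition SL3_mul A B : SL3 F := MkSL3 (SL3_mul_subproof A B).
Definition SL3_inv A : SL3 F := MkSL3 (SL3_inv_subproof A).

Fact SL3_mulA : associative SL3_mul.
Proof. by move=> A B C; apply: val_inj; rewrite /= mulmxA. Qed.
Fact SL3_mul1g : left_id SL3_one SL3_mul.
Proof. by move=> A; apply: val_inj; rewrite /= mul1mx. Qed.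
Fact SL3_mulg1 : right_id SL3_one SL3_mul.
Proof. by move=> A; apply: val_inj; rewrite /= mulmx1. Qed.
Fact SL3_mulVg : left_inverse SL3_one SL3_inv SL3_mul.
Proof. by move=> A; apply: val_inj; rewrite /= mulVmx ?SL3_unitmx. Qed.
Fact SL3_mulgV : right_inverse SL3_one SL3_inv SL3_mul.
Proof. by move=> A; apply: val_inj; rewrite /= mulmxV ?SL3_unitmx. Qed.

HB.instance Definition _ := isGroup.Build (SL3 F)
  SL3_mulA SL3_mul1g SL3_mulg1 SL3_mulVg SL3_mulgV.

End SL3Group.

Record finSubgroupSL3 (F : fieldType) := FinSubgroupSL3 {
  fsg_set : {fset SL3 F};
  fsg_closed : group_closed (fun A : SL3 F => A \in fsg_set)
}.

Definition fsg_type (F : fieldType) (Gam : finSubgroupSL3 F) : predArgType :=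
  fset_sub_type (fsg_set Gam).
Coercion fsg_type : finSubgroupSL3 >-> predArgType.

Section FinSubgroupGroup.
Variables (F : fieldType) (Gam : finSubgroupSL3 F).

HB.instance Definition _ := SubChoice.on (fsg_type Gam).
HB.instance Definition _ := Finite.on (fsg_type Gam).
HB.instance Definition _ :=
  SubChoice_isSubGroup.Build _ _ (fsg_type Gam) (fsg_closed Gam).

End FinSubgroupGroup.

Section GammaRepresentations.
Variables (F : fieldType) (Gam : finSubgroupSL3 F).

Fact natural_mx_repr : mx_repr [set: Gam]%G (fun x => val x : 'M[F]_3).
Proof. by []. Qed.
Definition natural_repr := MxRepresentation natural_mx_repr.

Fact dual_mx_repr n (rG : mx_representation F [set: Gam]%G n) :
  mx_repr [set: Gam]%G (fun x => (rG x^-1%g)^T).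
Proof.
split=> [|x y _ _]; first by rewrite invg1 repr_mx1 trmx1.
by rewrite invMg repr_mxM ?inE // trmx_mul.
Qed.
Definition dual_repr n (rG : mx_representation F [set: Gam]%G n) :=
  MxRepresentation (dual_mx_repr rG).

Variable l : nat.
Implicit Type gam : 'I_l.+1 -> representation F [set: Gam]%G.

(* mx_irreducible is phrased through right multiplication on row vectors; for
   the left action on columns this is the dual module, so irreducibility and
   similarity (mx_rsim) have their usual meaning for the columns as well. *)
Definition irr_representatives gam : Prop :=
  [/\ forall i, mx_irreducible (gam i),
      forall i j, mx_rsim (gam i) (gam j) -> i = j
    & forall n (rG : mx_representation F [set: Gam]%G n),
        mx_irreducible rG -> exists i, mx_rsim rG (gam i)].

Definition is_trivial_repr (rG : representation F [set: Gam]%G) : Prop :=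
  rdegree rG = 1%N /\ forall x, rG x = 1%:M.

Definition class_representatives (g : 'I_l.+1 -> Gam) : Prop :=
  forall x : Gam, exists! j : 'I_l.+1, x \in (g j ^: [set: Gam])%g.

Definition decomposes_as gam n (rG : mx_representation F [set: Gam]%G n)
    (k : 'I_l.+1 -> nat) : Prop :=
  mx_rsim rG (\big[dadd_grepr/grepr0]_(i < l.+1) muln_grepr (gam i) (k i)).

Definition char_table gam (g : 'I_l.+1 -> Gam) : 'M[F]_l.+1 :=
  \matrix_(i, j) \tr (gam i (g j)).

End GammaRepresentations.

(* A representation of SL_3 is a rational one: its matrix coefficients are
   polynomial functions of the nine entries of the group element (the
   denominators allowed by GL_3 are powers of the determinant, here 1). *)
Record SL3_representation (F : fieldType) (d : nat) := SL3Representation {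
  SL3_repr_mx :> SL3 F -> 'M[F]_d;
  SL3_repr1 : SL3_repr_mx 1%g = 1%:M;
  SL3_reprM : forall A B, SL3_repr_mx (A * B)%g = SL3_repr_mx A *m SL3_repr_mx B;
  SL3_repr_rational : forall i j, exists p : {mpoly F[3 * 3]},
    forall A, SL3_repr_mx A i j = p.@[mxvec A 0]
}.

Section SL3Representations.
Variables (F : fieldType) (d : nat).
Implicit Type rho : SL3_representation F d.

Definition SL3_irreducible rho : Prop :=
  (0 < d)%N /\
  forall W : {vspace 'cV[F]_d},
    (forall A w, w \in W -> rho A *m w \in W) -> W = 0%VS \/ W = fullv.

(* The fundamental weights of sl_3, as characters of the diagonal torus:
   epsilon_1 and epsilon_1 + epsilon_2. *)
Definition varpi1 (h : SL3 F) : F := h 0 0.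
Definition varpi2 (h : SL3 F) : F := h 0 0 * h 1 1.

Definition upper_unipotent (A : SL3 F) : Prop :=
  forall i j : 'I_3, (j <= i)%N -> A i j = (i == j)%:R.

(* The torus character below is the weight m varpi_1 + n varpi_2, the Borel
   subgroup being the upper triangular one. *)
Definition has_highest_weight rho (m n : nat) : Prop :=
  exists v : 'cV[F]_d,
    [/\ v != 0,
        forall A, upper_unipotent A -> rho A *m v = v
      & forall h : SL3 F, is_diag_mx h ->
          rho h *m v = (varpi1 h ^+ m * varpi2 h ^+ n) *: v].

Fact restriction_mx_repr (Gam : finSubgroupSL3 F) rho :
  mx_repr [set: Gam]%G (fun x => rho (val x)).
Proof.
split=> [|x y _ _]; first exact: SL3_repr1.
exact: (SL3_reprM rho (val x) (val y)).
Qed.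
Definition restriction_repr (Gam : finSubgroupSL3 F) rho :=
  MxRepresentation (restriction_mx_repr Gam rho).

End SL3Representations.

Section RationalFunctions.
Variable F : fieldType.

(* F[t, u] is {poly {poly F}}, with t the inner variable and u the outer one,
   so that the coefficient of t^m u^n in p is p`_n`_m. *)
Definition ratfun2 : fieldType := {fraction {poly {poly F}}}.

Definition ratcst (c : F) : ratfun2 := tofrac (c%:P%:P).
Definition rat_t : ratfun2 := tofrac ('X%:P).
Definition rat_u : ratfun2 := tofrac 'X.

(* The formal power series s is the expansion of the rational function r:
   r = p / q with q(0,0) <> 0, and q s = p as formal power series. *)
Definition is_expansion (r : ratfun2) (s : nat -> nat -> F) : Prop :=
  exists p q : {poly {poly F}},
    [/\ q`_0`_0 != 0,
        r = tofrac p / tofrac q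
      & forall m n : nat,
          \sum_(a < m.+1) \sum_(b < n.+1) q`_b`_a * s (m - a)%N (n - b)%N
            = p`_n`_m].

Definition f_rat (d1 d2 : F) : ratfun2 :=
  let t := rat_t in let u := rat_u in
  (1 - t * u) /
  ((1 - t * ratcst d1 + t ^+ 2 * ratcst d2 - t ^+ 3)
   * (1 - u * ratcst d2 + u ^+ 2 * ratcst d1 - u ^+ 3)).

End RationalFunctions.

(* Main.v *)
Require Import Defs.
From HB Require Import structures.
From mathcomp Require Import all_boot all_order all_algebra all_fingroup.
From mathcomp Require Import mxrepresentation character mxpoly separable cyclotomic.
From mathcomp Require Import finmap mpoly complex reals.
From mathcomp Require Import boolp ring zify.
Set Implicit Arguments.
Unset Strict Implicit.
Unset Printing Implicit Defensive.
Import Order.TTheory GRing.Theory Num.Theory.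
Local Open Scope ring_scope.

(* For a representation pi of SL_3 with highest weight vector v of weight (m, n)
   there is a linear form l (a component of the leading coefficient, as s -> 0,
   of pi(diag(1/s, 1, s))) such that
     l (pi(A) v) = A_00^m (A^-1)_22^n,
   because both sides agree on the big cell.  The Cauchy-Binet expansion of this
   coefficient at A B is sum_t c_t mon_t(A) mon_t(B) with c_t > 0, where mon_t
   runs over the monomials of bidegree (m, n) in the first column x and the last
   inverse row y of B, which satisfy x.y = 0.  Straightening with respect to
   x_1 y_1 = - x_0 y_0 - x_2 y_2 turns it into a positive definite form in the
   linearly independent standard monomials.  If pi is irreducible, its trace on
   the torus is therefore the sum of the weights of the standard monomials,
   h_m(x) h_n(1/x) - h_(m-1)(x) h_(n-1)(1/x), whose generating function is f.
   Elements of finite order are diagonalizable, and Schur orthogonality makes T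
   unitary up to the weights |C_j| / |Gamma|, which yields the remaining
   statements, complex conjugation accounting for T replacing its transpose. *)

(** * Polynomial functions of one variable *)

Lemma ord3P (P : 'I_3 -> Prop) : P 0 -> P 1 -> P 2 -> forall i, P i.
Proof.
move=> P0 P1 P2 [[|[|[|//]]] i3].
- by have -> : Ordinal i3 = 0 by apply: val_inj.
- by have -> : Ordinal i3 = 1 by apply: val_inj.
- by have -> : Ordinal i3 = 2 by apply: val_inj.
Qed.

Lemma sum3E (V : nmodType) (f : 'I_3 -> V) : \sum_i f i = f 0 + f 1 + f 2.
Proof.
rewrite !big_ord_recl big_ord0 addr0 addrA.
by congr (_ + f _ + f _); apply: val_inj.
Qed.

Section PolynomialFunctions.
Variable F : numFieldType.

(** Characteristic zero supplies [size p] distinct roots 0, 1, 2, ..., more than a nonzero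
    polynomial can have. *)
Lemma poly_fun_eq0 (p : {poly F}) : (forall s, p.[s] = 0) -> p = 0.
Proof.
move=> p0; apply/eqP; apply: contraT => nz_p.
have /= := @max_poly_roots _ p [seq i%:R | i <- iota 0 (size p)] nz_p.
rewrite size_map size_iota ltnn => -> //.
  by apply/allP=> x _; apply/eqP/p0.
by rewrite map_inj_uniq ?iota_uniq //; apply: (mulrIn (oner_neq0 F)).
Qed.

Lemma poly_fun_eq (r p q : {poly F}) :
  r != 0 -> (forall s, r.[s] != 0 -> p.[s] = q.[s]) -> p = q.
Proof.
move=> nz_r eq_pq; apply/eqP; rewrite -subr_eq0.
suff /eqP: (p - q) * r = 0 by rewrite mulf_eq0 (negPf nz_r) orbF.
apply: poly_fun_eq0 => s; rewrite hornerM.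
have [->|nz_rs] := eqVneq r.[s] 0; first by rewrite mulr0.
by rewrite hornerD hornerN eq_pq // subrr mul0r.
Qed.

Definition poly_fun (f : F -> F) := exists p : {poly F}, forall s, f s = p.[s].

Lemma poly_fun_cst c : poly_fun (fun=> c).
Proof. by exists c%:P => s; rewrite hornerC. Qed.

Lemma poly_fun_id : poly_fun id.
Proof. by exists 'X => s; rewrite hornerX. Qed.

Lemma poly_funM f g : poly_fun f -> poly_fun g -> poly_fun (fun s => f s * g s).
Proof. by move=> [p pE] [q qE]; exists (p * q) => s; rewrite hornerM pE qE. Qed.

Lemma poly_funX f n : poly_fun f -> poly_fun (fun s => f s ^+ n).
Proof. by move=> [p pE]; exists (p ^+ n) => s; rewrite horner_exp pE. Qed.

Lemma poly_fun_sum I (r : seq I) (f : I -> F -> F) :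
  (forall i, poly_fun (f i)) -> poly_fun (fun s => \sum_(i <- r) f i s).
Proof.
move=> polf; elim: r => [|i r [q qE]].
  by exists 0 => s; rewrite big_nil horner0.
have [p pE] := polf i.
by exists (p + q) => s; rewrite big_cons hornerD pE qE.
Qed.

Lemma poly_fun_prod I (r : seq I) (f : I -> F -> F) :
  (forall i, poly_fun (f i)) -> poly_fun (fun s => \prod_(i <- r) f i s).
Proof.
move=> polf; elim: r => [|i r [q qE]].
  by exists 1 => s; rewrite big_nil hornerC.
have [p pE] := polf i.
by exists (p * q) => s; rewrite big_cons hornerM pE qE.
Qed.

Lemma poly_fun_meval k (p : {mpoly F[k]}) (x : F -> 'I_k -> F) :
  (forall i, poly_fun (x^~ i)) -> poly_fun (fun s => p.@[x s]).
Proof.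
move=> polx.
have [q qE] : poly_fun (fun s =>
    \sum_(m <- msupp p) p@_m * \prod_(i < k) x s i ^+ m i).
  apply: poly_fun_sum => m; apply: poly_funM; first exact: poly_fun_cst.
  by apply: poly_fun_prod => i; apply: poly_funX.
by exists q => s; rewrite mevalE.
Qed.

(* The Laurent version: a simple pole of the arguments at 0 becomes a pole of
   bounded order of the value. *)
Lemma poly_fun_meval_pole k (p : {mpoly F[k]}) (y : F -> 'I_k -> F) N :
  (forall i, poly_fun (y^~ i)) -> (msize p <= N)%N ->
  exists q : {poly F},
    forall s, s != 0 -> s ^+ N * p.@[fun i => y s i / s] = q.[s].
Proof.
move=> poly pN.
have [q qE] : poly_fun (fun s => \sum_(m <- msupp p)
    p@_m * (s ^+ (N - mdeg m) * \prod_(i < k) y s i ^+ m i)).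
  apply: poly_fun_sum => m; apply: poly_funM; first exact: poly_fun_cst.
  apply: poly_funM; first exact/poly_funX/poly_fun_id.
  by apply: poly_fun_prod => i; apply: poly_funX.
exists q => s nz_s; rewrite -qE mevalE mulr_sumr.
apply: eq_big_seq => m /msize_mdeg_lt mp.
rewrite mulrCA; congr (_ * _).
have -> : \prod_(i < k) y s i ^+ m i =
    s ^+ mdeg m * \prod_(i < k) (y s i / s) ^+ m i.
  rewrite mdegE -prodrXr -big_split; apply: eq_bigr => i _ /=.
  by rewrite -exprMn mulrC divfK.
by rewrite mulrA -exprD subnK // (leq_trans (ltnW mp) pN).
Qed.

End PolynomialFunctions.

(** * The group SL_3 and its big cell *)

Definition mx3 (V : nmodType) (r : seq (seq V)) : 'M[V]_3 :=
  \matrix_(i, j) nth 0 (nth [::] r i) j.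

Section MatrixThree.
Variable F : fieldType.

Lemma det2E (A : 'M[F]_2) : \det A = A 0 0 * A 1 1 - A 0 1 * A 1 0.
Proof.
rewrite (expand_det_row _ 0) !big_ord_recl big_ord0 /cofactor !det_mx11 !mxE /=.
have e0 : lift (0 : 'I_2) (0 : 'I_1) = 1 by apply: val_inj.
have e1 : lift (1 : 'I_2) (0 : 'I_1) = 0 by apply: val_inj.
by rewrite !(e0, e1) /= !addn0 !add0n expr0 expr1; ring.
Qed.

Lemma det3E (A : 'M[F]_3) : \det A =
  A 0 0 * (A 1 1 * A 2 2 - A 1 2 * A 2 1)
  - A 0 1 * (A 1 0 * A 2 2 - A 1 2 * A 2 0)
  + A 0 2 * (A 1 0 * A 2 1 - A 1 1 * A 2 0).
Proof.
rewrite (expand_det_row _ 0) sum3E /cofactor !det2E !mxE /=.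
have e0 : lift (0 : 'I_3) (0 : 'I_2) = 1 by apply: val_inj.
have e1 : lift (0 : 'I_3) (1 : 'I_2) = 2 by apply: val_inj.
have e2 : lift (1 : 'I_3) (0 : 'I_2) = 0 by apply: val_inj.
have e3 : lift (1 : 'I_3) (1 : 'I_2) = 2 by apply: val_inj.
have e4 : lift (2 : 'I_3) (0 : 'I_2) = 0 by apply: val_inj.
have e5 : lift (2 : 'I_3) (1 : 'I_2) = 1 by apply: val_inj.
rewrite !(e0, e1, e2, e3, e4, e5).
by rewrite !addn0 !add0n /= !expr0 !expr1 sqrrN expr1n; ring.
Qed.

Definition mkSL3 (A : 'M[F]_3) (detA : \det A = 1) : SL3 F :=
  MkSL3 (introT eqP detA).

Lemma SL3_invE (A : SL3 F) : (A^-1%g : SL3 F) = invmx A :> 'M_3.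
Proof. by []. Qed.

Lemma SL3_mulmxV (A : SL3 F) : A *m invmx A = 1%:M.
Proof. exact/mulmxV/SL3_unitmx. Qed.

Lemma SL3_mulVmx (A : SL3 F) : invmx A *m A = 1%:M.
Proof. exact/mulVmx/SL3_unitmx. Qed.

Definition lowmx (a b c : F) := mx3 [:: [:: 1; 0; 0]; [:: a; 1; 0]; [:: b; c; 1]].

Lemma det_lowmx a b c : \det (lowmx a b c) = 1.
Proof. by rewrite det3E !mxE /=; ring. Qed.

Definition low a b c : SL3 F := mkSL3 (det_lowmx a b c).

Lemma low_inv a b c : (low a b c)^-1%g = low (- a) (a * c - b) (- c).
Proof.
apply/eqP; rewrite eq_sym -mulg_eq1; apply/eqP/val_inj/matrixP => i j.
rewrite /= mxE sum3E /lowmx !mxE /=.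
by elim/ord3P: i; elim/ord3P: j => /=; ring.
Qed.

End MatrixThree.

Section BigCell.
Variable F : fieldType.

(* The last column of the upper unipotent factor is that of the inverse matrix,
   normalised, since A maps the latter to a basis vector. *)
Lemma big_cell (A : SL3 F) : A 0 0 != 0 -> invmx A 2 2 != 0 ->
  exists L h U : SL3 F,
  [/\ A = (L * h * U)%g,
      exists a b c, L = low a b c,
      is_diag_mx h, upper_unipotent U
      & varpi1 h = A 0 0 /\ varpi2 h = invmx A 2 2].
Proof.
move=> nzA nzD; set D := invmx A 2 2 in nzD *.
pose s i := invmx A i 2.
have eqA i : A i 0 * s 0 + A i 1 * s 1 + A i 2 * s 2 = (i == 2)%:R.
  by have := congr1 (fun M : 'M_3 => M i 2) (SL3_mulmxV A); rewrite !mxE sum3E.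
have e0 := eqA 0; have e1 := eqA 1; have e2 := eqA 2.
rewrite /= ?mulr0n ?mulr1n in e0 e1 e2.
(* The second column clears entry (0, 1); the third is mapped by [A] to the last basis vector
   divided by [D]. Hence A U is lower triangular. *)
pose Um := mx3 [:: [:: 1; - (A 0 1 / A 0 0); s 0 / D]; [:: 0; 1; s 1 / D];
                   [:: 0; 0; 1]].
have detU : \det Um = 1 by rewrite det3E !mxE /=; ring.
pose U := mkSL3 detU.
have sD : s 2 = D by [].
pose M := (A * U)%g.
have ME : M = mx3 [:: [:: A 0 0; 0; 0];
   [:: A 1 0; A 1 1 - A 1 0 * A 0 1 / A 0 0; 0];
   [:: A 2 0; A 2 1 - A 2 0 * A 0 1 / A 0 0; D^-1]] :> 'M_3.
  apply/matrixP => i j; rewrite /= mxE sum3E !mxE /=.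
  elim/ord3P: i; elim/ord3P: j => //=; rewrite -?sD.
  - by ring.
  - by field.
  - have -> : A 0 0 * (s 0 / s 2) + A 0 1 * (s 1 / s 2) + A 0 2 * 1 =
      (A 0 0 * s 0 + A 0 1 * s 1 + A 0 2 * s 2) / s 2 by field; rewrite sD.
    by rewrite e0 mul0r.
  - by ring.
  - by field.
  - have -> : A 1 0 * (s 0 / s 2) + A 1 1 * (s 1 / s 2) + A 1 2 * 1 =
      (A 1 0 * s 0 + A 1 1 * s 1 + A 1 2 * s 2) / s 2 by field; rewrite sD.
    by rewrite e1 mul0r.
  - by ring.
  - by field.
  - have -> : A 2 0 * (s 0 / s 2) + A 2 1 * (s 1 / s 2) + A 2 2 * 1 =
      (A 2 0 * s 0 + A 2 1 * s 1 + A 2 2 * s 2) / s 2 by field; rewrite sD.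
    by rewrite e2 div1r.
have MAU : M = (A * U)%g by [].
clearbody M; have detM : M 0 0 * M 1 1 * M 2 2 = 1.
  rewrite -(SL3_det M) det3E.
  have -> : M 0 1 = 0 by rewrite ME mxE.
  have -> : M 0 2 = 0 by rewrite ME mxE.
  have -> : M 1 2 = 0 by rewrite ME mxE.
  by ring.
have M00 : M 0 0 = A 0 0 by rewrite ME mxE.
have M22 : M 2 2 = D^-1 by rewrite ME mxE.
have nzM1 : M 1 1 != 0.
  apply/eqP => M10; move: detM; rewrite M10 mulr0 mul0r => /esym/eqP.
  by rewrite oner_eq0.
have dH : \det (mx3 [:: [:: M 0 0; 0; 0]; [:: 0; M 1 1; 0]; [:: 0; 0; M 2 2]]) = 1.
  by rewrite det3E -[RHS]detM !mxE /=; ring.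
pose h := mkSL3 dH.
pose L := low (M 1 0 / M 0 0) (M 2 0 / M 0 0) (M 2 1 / M 1 1).
have MLh : M = (L * h)%g.
  apply: val_inj; apply/matrixP => i j; rewrite [in RHS]/= mxE sum3E !mxE.
  have nzM0 : M 0 0 != 0 by rewrite M00.
  elim/ord3P: i; elim/ord3P: j => //=; try by [ring|field; rewrite ?nzM0 ?nzM1].
  + by rewrite {1}ME mxE /=; ring.
  + by rewrite {1}ME mxE /=; ring.
  + by rewrite {1}ME mxE /=; ring.
exists L, h, (U^-1)%g; split.
- by rewrite -MLh MAU mulgK.
- by exists (M 1 0 / M 0 0), (M 2 0 / M 0 0), (M 2 1 / M 1 1).
- by apply/is_diag_mxP => i j; rewrite !mxE; elim/ord3P: i; elim/ord3P: j.
- pose V := mx3 [:: [:: 1; - Um 0 1; Um 0 1 * Um 1 2 - Um 0 2];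
                    [:: 0; 1; - Um 1 2]; [:: 0; 0; 1]].
  have detV : \det V = 1 by rewrite det3E !mxE /=; ring.
  have UV : (U^-1)%g = mkSL3 detV.
    apply/eqP; rewrite eq_sym -mulg_eq1; apply/eqP/val_inj/matrixP => i j.
    rewrite /= mxE sum3E !mxE /=.
    by elim/ord3P: i; elim/ord3P: j => /=; ring.
  move=> i j; rewrite UV !mxE; elim/ord3P: i; elim/ord3P: j => //=.
- split; first by rewrite /varpi1 mxE.
  rewrite /varpi2 !mxE /=; apply: (mulIf (invr_neq0 nzD)).
  by rewrite -{1}M22 detM divff.
Qed.
End BigCell.

(** * The matrix coefficient of a highest weight vector *)

Section HighestWeightFunctional.
Variables (F : numFieldType) (d m n : nat) (rho : SL3_representation F d).

Lemma poly_fun_SL3_repr (B : F -> SL3 F) :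
  (forall i j, poly_fun (fun s => B s i j)) ->
  forall i j, poly_fun (fun s => rho (B s) i j).
Proof.
move=> polB i j; have [p pE] := SL3_repr_rational rho i j.
have [q qE] : poly_fun (fun s => p.@[mxvec (B s) 0]).
  apply: poly_fun_meval => k; case/mxvec_indexP: k => k1 k2.
  by have [q qE] := polB k1 k2; exists q => s; rewrite mxvecE.
by exists q => s; rewrite pE.
Qed.

Lemma poly_fun_mulmx k1 k2 k3 (A : F -> 'M[F]_(k1, k2)) (B : F -> 'M[F]_(k2, k3)) :
  (forall i j, poly_fun (fun s => A s i j)) ->
  (forall i j, poly_fun (fun s => B s i j)) ->
  forall i j, poly_fun (fun s => (A s *m B s) i j).
Proof.
move=> polA polB i j.
have [q qE] : poly_fun (fun s => \sum_k A s i k * B s k j).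
  by apply: poly_fun_sum => k; apply: poly_funM.
by exists q => s; rewrite mxE.
Qed.

(** The entries of diag(1/s, 1, s) are those of diag(1, s, s^2) divided by s, so one power of s
    clears the poles of all matrix coefficients at once. *)
Lemma SL3_repr_pole :
  exists N0, forall N, (N0 <= N)%N ->
  exists P : 'I_d -> 'I_d -> {poly F},
    forall s (h : SL3 F), s != 0 ->
      h = mx3 [:: [:: s^-1; 0; 0]; [:: 0; 1; 0]; [:: 0; 0; s]] :> 'M_3 ->
      forall i j, s ^+ N * rho h i j = (P i j).[s].
Proof.
have [p pE] : exists p : 'I_d * 'I_d -> {mpoly F[3 * 3]},
    forall ij A, rho A ij.1 ij.2 = (p ij).@[mxvec A 0].
  apply: (fin_all_exists (P := fun (ij : 'I_d * 'I_d) p =>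
    forall A, rho A ij.1 ij.2 = p.@[mxvec A 0])) => ij.
  exact: SL3_repr_rational.
exists (\max_ij msize (p ij)) => N leN.
pose Y (s : F) := mx3 [:: [:: 1; 0; 0]; [:: 0; s; 0]; [:: 0; 0; s ^+ 2]].
have polY k : poly_fun (fun s => mxvec (Y s) 0 k).
  case/mxvec_indexP: k => k1 k2.
  suff [q qE] : poly_fun (fun s => Y s k1 k2) by exists q => s; rewrite mxvecE.
  exists ((fun i j : 'I_3 => if i == j then 'X ^+ i else 0) k1 k2) => s.
  rewrite mxE; elim/ord3P: k1; elim/ord3P: k2;
    by rewrite /= ?horner0 ?hornerXn ?expr0 ?expr1.
have polp ij : exists q : {poly F}, forall s, s != 0 ->
    s ^+ N * (p ij).@[fun k => mxvec (Y s) 0 k / s] = q.[s].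
  apply: (poly_fun_meval_pole (y := fun s k => mxvec (Y s) 0 k)) => //.
  apply: leq_trans leN.
  exact: (leq_bigmax_cond (F := fun ij => msize (p ij))).
have [P PE] := fin_all_exists polp.
exists (fun i j => P (i, j)) => s h nz_s hE i j.
rewrite -PE // (pE (i, j)); congr (_ * _); apply: meval_eq => k.
case/mxvec_indexP: k => k1 k2; rewrite !mxvecE hE !mxE.
elim/ord3P: k1; elim/ord3P: k2; rewrite //= ?mul0r ?mul1r //.
  by rewrite divff.
by rewrite expr2 mulfK.
Qed.

Variable v : 'cV[F]_d.
Hypothesis nz_v : v != 0.
Hypothesis unip_v : forall A, upper_unipotent A -> rho A *m v = v.
Hypothesis tor_v : forall h : SL3 F, is_diag_mx h ->
  rho h *m v = (varpi1 h ^+ m * varpi2 h ^+ n) *: v.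

(* Conjugating a lower unipotent u by diag(1/s, 1, s) gives u(s), polynomial in
   s with u(0) = 1, so that rho(diag(1/s, 1, s)) rho(u) v = s^-(m+n) rho(u(s)) v.
   The matrix E is the coefficient of s^-(m+n) in rho(diag(1/s, 1, s)). *)
Lemma lowest_coef_low :
  exists E : 'M[F]_d, forall a b c, E *m (rho (low a b c) *m v) = v.
Proof.
have [N0 polN] := SL3_repr_pole.
(* Adding m + n makes the difference N - (m + n) exact. As P represents s^N rho(h), its coefficient
   of degree N - (m + n) is that of s^-(m+n) in rho(h). *)
pose N := (N0 + (m + n))%N.
have [P PE] := polN N (leq_addr _ _).
exists (\matrix_(i, j) (P i j)`_(N - (m + n))) => a b c.
apply/matrixP => i j; rewrite {}[j]ord1 mxE.
set w := rho _ *m v.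
pose u s : SL3 F := low (s * a) (s ^+ 2 * b) (s * c).
have [q qE] : poly_fun (fun s => (rho (u s) *m v) i 0).
  apply: poly_fun_mulmx => [k1 k2|k1 k2]; last exact: poly_fun_cst.
  apply: poly_fun_SL3_repr => l1 l2.
  suff [q qE] : poly_fun (fun s => lowmx (s * a) (s ^+ 2 * b) (s * c) l1 l2).
    by exists q.
  exists ((fun x y : 'I_3 => if x == y then 1 else
    if (y < x)%N then (lowmx a b c x y)%:P * 'X ^+ (x - y) else 0) l1 l2) => s.
  rewrite !mxE; elim/ord3P: l1; elim/ord3P: l2;
    rewrite /= ?mxE /= ?horner0 ?hornerC //;
    by rewrite hornerM hornerC hornerXn ?expr1 mulrC.
(* For s <> 0 both sides evaluate to s^N (rho(h) w)_i. In degree N - (m + n) the left side gives (E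
   w)_i and the right side q(0) = v_i, because u(0) = 1. *)
have eqq : \sum_k (w k 0) *: P i k = 'X^(N - (m + n)) * q.
  apply: (@poly_fun_eq _ 'X) => [|s]; first by rewrite polyX_eq0.
  rewrite hornerX => nz_s.
  have det_h : \det (mx3 [:: [:: s^-1; 0; 0]; [:: 0; 1; 0]; [:: 0; 0; s]]) = 1.
    by rewrite det3E !mxE /=; field.
  pose h := mkSL3 det_h.
  have uh : (h * low a b c)%g = (u s * h)%g.
    apply: val_inj; apply/matrixP => k l; rewrite /= !mxE !sum3E !mxE.
    by elim/ord3P: k; elim/ord3P: l => //=; field.
  have diag_h : is_diag_mx h.
    by apply/is_diag_mxP => k l; rewrite !mxE; elim/ord3P: k; elim/ord3P: l.
  have hw : rho h *m w = s ^- (m + n) *: (rho (u s) *m v).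
    rewrite mulmxA -SL3_reprM uh SL3_reprM -mulmxA tor_v // -scalemxAr.
    congr (_ *: _); rewrite /varpi1 /varpi2 !mxE /= mulr1 -exprD.
    by rewrite exprVn.
  rewrite horner_sum hornerM hornerXn -qE.
  transitivity (s ^+ N * (rho h *m w) i 0).
    rewrite mxE mulr_sumr; apply: eq_bigr => k _.
    rewrite hornerZ -(PE s h) //; ring.
  rewrite hw mxE mulrA; congr (_ * _).
  by rewrite -[N in LHS](subnK (leq_addl N0 _)) exprD mulfK // expf_neq0.
have -> : v i 0 = q`_0.
  rewrite -horner_coef0 -qE /u; have -> : low (0 * a) (0 ^+ 2 * b) (0 * c) = 1%g.
    apply: val_inj; apply/matrixP => k l; rewrite !mxE.
    by elim/ord3P: k; elim/ord3P: l => //=; rewrite ?expr2 ?mul0r.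
  by rewrite SL3_repr1 mul1mx.
transitivity (('X^(N - (m + n)) * q)`_(N - (m + n))).
  rewrite -eqq coef_sum; apply: eq_bigr => k _.
  by rewrite mxE coefZ mulrC.
by rewrite coefXnM ltnn subnn.
Qed.

(** On the big cell A = L h U, the factor U fixes v, h scales it, and l takes the value 1 on every L
    v. Any other A is joined to the big cell by a polynomial curve A B(s) with B(0) = 1. *)
Lemma highest_weight_functional : exists l : 'rV[F]_d,
  forall A, (l *m (rho A *m v)) 0 0 = A 0 0 ^+ m * invmx A 2 2 ^+ n.
Proof.
have [E Ev] := lowest_coef_low.
have /cV0Pn[i0 nz_vi] := nz_v.
pose l : 'rV_d := (v i0 0)^-1 *: delta_mx 0 i0 *m E.
have lv a b c : (l *m (rho (low a b c) *m v)) 0 0 = 1.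
  rewrite -mulmxA Ev -scalemxAl mxE -rowE mxE mulVf //.
clearbody l; exists l => A.
have cell (B : SL3 F) : B 0 0 != 0 -> invmx B 2 2 != 0 ->
    (l *m (rho B *m v)) 0 0 = B 0 0 ^+ m * invmx B 2 2 ^+ n.
  move=> nzB nzD; have [L [h [U [BE [a [b [c LE]]] diag_h uniU [<- <-]]]]] := 
    big_cell nzB nzD.
  rewrite BE LE !SL3_reprM -!mulmxA unip_v // tor_v // -!scalemxAr mxE.
  by rewrite lv mulr1.
(* The first column (1, s, s^2) of B(s) and the last row (s^2, -2 s, 1) of its inverse have linearly
   independent entries, so neither (A B)_00 nor (A B)^-1_22 vanishes identically in s. *)
pose B s : SL3 F := low s (s ^+ 2) (2 * s).
have polB i j : poly_fun (fun s => B s i j).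
  exists (mx3 [:: [:: 1; 0; 0]; [:: 'X; 1; 0]; [:: 'X^2; 2 *: 'X; 1]] i j) => s.
  rewrite !mxE; elim/ord3P: i; elim/ord3P: j;
    by rewrite /= ?hornerC ?horner0 ?hornerXn ?hornerZ ?hornerX.
have polAB i j : poly_fun (fun s => (A * B s)%g i j).
  by apply: poly_fun_mulmx => // k1 k2; apply: poly_fun_cst.
have [f fE] : poly_fun (fun s => (l *m (rho (A * B s)%g *m v)) 0 0).
  apply: poly_fun_mulmx => [k1 k2|]; first exact: poly_fun_cst.
  apply: poly_fun_mulmx => [|k1 k2]; last exact: poly_fun_cst.
  exact: poly_fun_SL3_repr.
pose quad x y z : {poly F} := x%:P + y *: 'X + z *: 'X^2.
have nz_quad x y z : quad x y z = 0 -> [/\ x = 0, y = 0 & z = 0].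
  by move=> q0; split; [move: (congr1 (coefp 0) q0)|move: (congr1 (coefp 1) q0)
    |move: (congr1 (coefp 2) q0)];
    rewrite /= !coefD !coefZ coefX coefXn coefC coef0 /= => <-; ring.
pose p := quad (A 0 0) (A 0 1) (A 0 2).
pose q := quad (invmx A 2 2) (- 2 * invmx A 1 2) (invmx A 0 2).
have quadE x y z s : (quad x y z).[s] = x + y * s + z * s ^+ 2.
  by rewrite !hornerD !hornerZ hornerC hornerX hornerXn.
have pE s : (A * B s)%g 0 0 = p.[s].
  by rewrite mxE sum3E quadE !mxE /= mulr1.
have qE s : invmx (A * B s)%g 2 2 = q.[s].
  rewrite -SL3_invE invMg low_inv mxE sum3E quadE !mxE /=; ring.
have nz_p : p != 0.
  apply/eqP=> /nz_quad[A0 A1 A2].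
  have /eqP := congr1 (fun M : 'M_3 => M 0 0) (SL3_mulmxV A).
  by rewrite !mxE sum3E A0 A1 A2 !mul0r !addr0 eq_sym oner_eq0.
have nz_q : q != 0.
  apply/eqP=> /nz_quad[A2 /eqP A1 A0].
  rewrite mulf_eq0 oppr_eq0 pnatr_eq0 /= in A1.
  have /eqP := congr1 (fun M : 'M_3 => M 2 2) (SL3_mulmxV A).
  by rewrite !mxE sum3E A0 (eqP A1) A2 !mulr0 !addr0 eq_sym oner_eq0.
have fpq : f = p ^+ m * q ^+ n.
  apply: (@poly_fun_eq _ (p * q)) => [|s]; first by rewrite mulf_neq0.
  rewrite !hornerM mulf_eq0 => /norP[nzp nzq].
  by rewrite !horner_exp -fE cell ?pE ?qE.
have B0 : B 0 = 1%g.
  apply: val_inj; apply/matrixP => k l'; rewrite !mxE mulr0 expr2 mulr0.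
  by elim/ord3P: k; elim/ord3P: l'.
by have := fE 0; rewrite fpq hornerM !horner_exp -pE -qE B0 mulg1.
Qed.
End HighestWeightFunctional.

(** * Traces from matrix coefficients *)

(** Take W of maximal dimension among the subspaces contained in P: an element of P outside W could
    be adjoined to it. The argument is classical, P being an arbitrary predicate. *)
Lemma predicate_vspace (F : fieldType) (V : vectType F) (P : V -> Prop) :
  P 0 -> (forall a u w, P u -> P w -> P (a *: u + w)) ->
  exists W : {vspace V}, forall w, w \in W <-> P w.
Proof.
move=> P0 Plin.
pose Q k := `[< exists2 W : {vspace V}, \dim W = k & forall w, w \in W -> P w >].
have exQ : exists k, Q k.
  exists 0%N; apply/asboolP; exists 0%VS; first exact: dimv0.
  by move=> w; rewrite memv0 => /eqP->.
have ubQ k : Q k -> (k <= \dim {:V})%N.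
  by move=> /asboolP[W <- _]; apply: dimvS; apply: subvf.
case: (ex_maxnP exQ ubQ) => k /asboolP[W dimW WP] maxk.
exists W => w; split=> [/WP//|Pw]; apply: contrapT => /negP wW.
suff /maxk : Q (\dim (W + <[w]>)%VS).
  rewrite -dimW leqNgt => /negP[].
  rewrite ltn_neqAle dimvS ?addvSl // andbT.
  apply: contra wW => /eqP eqd.
  have /eqP -> : W == (W + <[w]>)%VS by rewrite eqEdim addvSl -eqd leqnn.
  by apply: (subvP (addvSr _ _)); apply: memv_line.
apply/asboolP; exists (W + <[w]>)%VS => // _ /memv_addP[u uW [_ /vlineP[a ->] ->]].
by rewrite addrC; apply: Plin => //; apply: WP.
Qed.

(** Points are added one at a time. While their number r is below N, a nonzero column c is killed by
    the rows found so far; independence gives x with f x c <> 0, so the new row lies outside their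
    span. *)
Lemma unit_evaluation_points (F : fieldType) (X : Type) N (f : X -> 'rV[F]_N) :
  (forall c : 'cV_N, (forall x, f x *m c = 0) -> c = 0) ->
  exists xs : 'I_N -> X, (\matrix_i f (xs i)) \in unitmx.
Proof.
move=> indep.
suff free r : (r <= N)%N -> exists xs : 'I_r -> X, row_free (\matrix_i f (xs i)).
  by have [xs] := free N (leqnn N); rewrite row_free_unit; exists xs.
elim: r => [_|r IHr ltrN].
  have xs : 'I_0 -> X by case.
  exists xs; rewrite /row_free (flatmx0 (\matrix_i _)) mxrank0 //.
have [xs freeM] := IHr (ltnW ltrN); set M := \matrix_i _ in freeM.
have [j nzc] : exists j, col j (cokermx M) != 0.
  apply: contrapT => noj; suff : \rank (cokermx M) = 0%N.
    by rewrite mxrank_coker (eqP freeM) => /eqP; rewrite subn_eq0 leqNgt ltrN.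
  apply/eqP; rewrite mxrank_eq0; apply/eqP/matrixP => i j; rewrite [RHS]mxE.
  have /eqP/matrixP/(_ i 0) : col j (cokermx M) == 0.
    by apply: contraT => nzc; case: noj; exists j.
  by rewrite !mxE.
set c := col j _ in nzc.
have Mc : M *m c = 0 by rewrite /c colE mulmxA mulmx_coker mul0mx.
have [x nzx] : exists x, f x *m c != 0.
  apply: contrapT => nox; case/eqP: nzc; apply: indep => x.
  by apply/eqP; apply: contraT => nzx; case: nox; exists x.
exists (fun i => if unlift ord0 i is Some k then xs k else x).
apply/row_freeP; set M' := \matrix_i _.
have M'E u : u *m M' = u 0 0 *: f x + (\row_k u 0 (lift ord0 k)) *m M.
  rewrite mulmx_sum_row big_ord_recl rowK unlift_none; congr (_ + _).
  rewrite mulmx_sum_row; apply: eq_bigr => k _.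
  by rewrite !rowK liftK mxE.
have inj (u : 'rV_r.+1) : u *m M' = 0 -> u = 0.
  rewrite M'E => u0.
  have /eqP u00 : u 0 0 == 0.
    have := congr1 (mulmxr c) u0; rewrite /= mulmxDl -mulmxA Mc mulmx0 addr0.
    rewrite mul0mx -scalemxAl => /eqP; rewrite scaler_eq0 (negPf nzx) orbF //.
  rewrite u00 scale0r add0r in u0.
  have uM0 : \row_k u 0 (lift ord0 k) = 0.
    by apply: (row_free_inj freeM); rewrite mul0mx.
  apply/rowP => i; rewrite mxE; case: (unliftP ord0 i) => [k ->|-> //].
  by have /rowP/(_ k) := uM0; rewrite !mxE.
apply/row_freeP; rewrite -kermx_eq0; apply/eqP/row_matrixP => i.
by rewrite row0; apply: inj; rewrite -row_mul mulmx_ker row0.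
Qed.

Lemma mulmx_col (F : fieldType) k1 k2 k3 (A : 'M[F]_(k1, k2)) (B : 'M_(k2, k3)) j :
  A *m col j B = col j (A *m B).
Proof. by rewrite !colE mulmxA. Qed.

Section MatrixCoefficientTrace.
Variables (F : fieldType) (d : nat) (rho : SL3_representation F d).
Hypothesis irr_rho : SL3_irreducible rho.

(** The vectors whose whole orbit is killed by phi form a stable subspace, which is proper (take A =
    1), hence zero. *)
Lemma SL3_irreducible_cyclic (phi : 'rV[F]_d) (w : 'cV_d) :
  phi != 0 -> (forall A, phi *m (rho A *m w) = 0) -> w = 0.
Proof.
have [_ irr] := irr_rho => nz_phi phiw.
have [W WP] : exists W : {vspace 'cV[F]_d},
    forall w, w \in W <-> forall A, phi *m (rho A *m w) = 0.
  apply: predicate_vspace => [A|a u z uW zW A]; first by rewrite !mulmx0.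
  by rewrite !mulmxDr -!scalemxAr uW zW scaler0 addr0.
have stabW A z : z \in W -> rho A *m z \in W.
  by move=> /WP zW; apply/WP => B; rewrite [rho B *m _]mulmxA -SL3_reprM zW.
have [W0|Wf] := irr W stabW.
  by apply/eqP; rewrite -memv0 -W0; apply/WP.
case/eqP: nz_phi; apply/rowP => i; rewrite [RHS]mxE.
have /WP/(_ 1%g) : delta_mx i 0 \in W by rewrite Wf memvf.
by rewrite SL3_repr1 mul1mx -colE => /matrixP/(_ 0 0); rewrite !mxE.
Qed.

Variables (v : 'cV[F]_d) (l : 'rV[F]_d) (N : nat).
Variables (a : SL3 F -> 'rV[F]_N) (G : 'M[F]_N) (b : SL3 F -> 'cV[F]_N).
Hypothesis nz_v : v != 0.
Hypothesis nz_l : l != 0.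
Hypothesis coefE : forall A B, l *m (rho (A * B)%g *m v) = a A *m G *m b B.
Hypothesis G_unit : G \in unitmx.
Hypothesis a_indep : forall c : 'cV_N, (forall A, a A *m c = 0) -> c = 0.
Hypothesis b_indep : forall c : 'rV_N, (forall B, c *m b B = 0) -> c = 0.

(** At suitable sample points, the rows l rho(A_i) and the columns rho(B_j) v form matrices with VA
    VB = K, where K = EA G EB is invertible. Irreducibility yields VB K^-1 VA = 1, and cyclicity of
    the trace then reduces rho(D) to diag(w). *)
Lemma matrix_coefficient_trace (D : SL3 F) (w : 'rV[F]_N) :
  (forall B, b (D * B)%g = diag_mx w *m b B) -> \tr (rho D) = \sum_i w 0 i.
Proof.
move=> bD.
have [As unitA] := unit_evaluation_points a_indep.
have [Bs unitB] : exists Bs : 'I_N -> SL3 F, (\matrix_i (b (Bs i))^T) \in unitmx.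
  apply: (unit_evaluation_points (f := fun B => (b B)^T)) => c bc; apply: trmx_inj; rewrite trmx0.
  by apply: b_indep => B; apply: trmx_inj; rewrite trmx_mul trmxK trmx0.
set EA := \matrix_i _ in unitA; set EBt := \matrix_i _ in unitB.
pose EB := EBt^T.
have unitEB : EB \in unitmx by rewrite unitmx_tr.
have colEB j : col j EB = b (Bs j) by rewrite -tr_row rowK trmxK.
pose VA := \matrix_i (l *m rho (As i)).
pose VB := (\matrix_j (rho (Bs j) *m v)^T)^T.
have colVB j : col j VB = rho (Bs j) *m v by rewrite -tr_row rowK trmxK.
have coefD C (w' : 'rV_N) : (forall B, b (C * B)%g = diag_mx w' *m b B) ->
    VA *m rho C *m VB = EA *m G *m diag_mx w' *m EB.
  move=> bC; apply/row_matrixP => i; apply/rowP => j.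
  rewrite -!mulmxA !row_mul !rowK.
  transitivity ((l *m (rho (As i * (C * Bs j))%g *m v)) 0 0).
    by rewrite !SL3_reprM -!mulmxA -colVB !mulmx_col [RHS]mxE.
  by rewrite coefE bC -colEB !mulmx_col [LHS]mxE -!mulmxA.
have VAB : VA *m VB = EA *m G *m EB.
  have := @coefD 1%g (const_mx 1); rewrite SL3_repr1 diag_const_mx !mulmx1; apply.
  by move=> B; rewrite mul1g mul1mx.
pose K := EA *m G *m EB.
have unitK : K \in unitmx by rewrite !unitmx_mul unitA G_unit unitEB.
(* Both sides pair equally with every l rho(A), so they coincide by irreducibility. *)
have spanB B : rho B *m v = VB *m (invmx EB *m b B).
  apply/eqP; rewrite -subr_eq0; apply/eqP.
  apply: (SL3_irreducible_cyclic nz_l) => A; rewrite !mulmxBr.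
  rewrite (mulmxA (rho A)) -SL3_reprM coefE.
  have lVB : l *m (rho A *m VB) = a A *m G *m EB.
    apply/rowP => j.
    transitivity ((l *m (rho (A * Bs j)%g *m v)) 0 0).
      by rewrite SL3_reprM -mulmxA -colVB !mulmx_col [RHS]mxE.
    by rewrite coefE -colEB mulmx_col [LHS]mxE.
  by rewrite (mulmxA (rho A)) (mulmxA l) lVB -!mulmxA mulKVmx // subrr.
(* By [spanB] a row vector that kills VB kills the whole orbit of v. *)
have freeVB : row_free VB.
  rewrite -kermx_eq0; apply/eqP/row_matrixP => i; rewrite row0.
  apply/eqP; apply: contraT => nzk; case/negP: nz_v; apply/eqP.
  apply: (SL3_irreducible_cyclic nzk) => A.
  by rewrite spanB mulmxA -row_mul mulmx_ker row0 mul0mx.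
have PVB : VB *m invmx K *m VA = 1%:M.
  by apply: (row_free_inj freeVB); rewrite mul1mx -!mulmxA VAB mulVmx // mulmx1.
rewrite -[rho D]mulmx1 -PVB.
transitivity (\tr (EA *m G *m diag_mx w *m EB *m invmx K)).
  by rewrite 2![in LHS]mulmxA mxtrace_mulC !mulmxA (coefD _ _ bD).
have EBK : EB *m (invmx K *m (EA *m G)) = 1%:M.
  apply: (can_inj (mulmxK unitEB)).
  by rewrite mul1mx -!mulmxA (mulmxA EA) mulVmx ?mulmx1.
rewrite -!(mulmxA (EA *m G)) mxtrace_mulC -!mulmxA EBK mulmx1.
exact: mxtrace_diag.
Qed.
End MatrixCoefficientTrace.

(** * Standard monomials *)

(** Comparison of the coefficients of s^z; omitting the single value s0 does not affect a polynomial
    identity. *)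
Lemma poly_fun_coef0 (F : numFieldType) (I : finType) (P : pred I) (c : I -> F)
    (e : I -> nat) (s0 : F) z :
  (forall s, s != s0 -> \sum_(i | P i) c i * s ^+ e i = 0) ->
  \sum_(i | P i && (e i == z)) c i = 0.
Proof.
move=> sum0; pose p := \sum_(i | P i) c i *: 'X^(e i).
have p0 : p = 0.
  apply: (@poly_fun_eq _ ('X - s0%:P)) => [|s]; first by rewrite polyXsubC_eq0.
  rewrite !hornerE subr_eq0 => /sum0 <-.
  by rewrite horner_sum; apply: eq_bigr => i _; rewrite hornerZ hornerXn.
transitivity (p`_z); last by rewrite p0 coef0.
rewrite coef_sum big_mkcondr; apply: eq_bigr => i _.
by rewrite coefZ coefXn eq_sym; case: eqP; rewrite ?mulr1 ?mulr0.
Qed.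

(** For k = m the exponent is k' <= n, and for k' = n it is m - k + n >= n. These ranges meet only
    at (m, n), so the exponent determines a standard pair. *)
Lemma standard_exponent m n k k' k0 k0' :
  (k <= m)%N -> (k' <= n)%N -> (k0 <= m)%N -> (k0' <= n)%N ->
  (k == m) || (k' == n) -> (k0 == m) || (k0' == n) ->
  (m - k + k' == m - k0 + k0')%N = (k == k0) && (k' == k0').
Proof. lia. Qed.

Section Monomials.
Variable F : numClosedFieldType.

(** A monomial of degree N when j <= k <= N. Indices j > k, where the subtraction truncates, are
    discarded by a vanishing binomial or by the condition j <= k. *)
Definition trimon N (p q r : F) k j := p ^+ (N - k) * q ^+ (k - j) * r ^+ j.

Lemma trinomial N (p q r p' q' r' : F) :
  (p * p' + (q * q' + r * r')) ^+ N =
  \sum_(k < N.+1) \sum_(j < N.+1) ('C(N, k) * 'C(k, j))%:R *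
     (trimon N p q r k j * trimon N p' q' r' k j).
Proof.
rewrite exprDn; apply: eq_bigr => k _; rewrite exprDn.
rewrite (big_ord_widen N.+1 (fun j => ((q * q') ^+ (k - j) * (r * r') ^+ j)
  *+ 'C(k, j))) ?ltn_ord // big_mkcond /= mulr_sumr -sumrMnl.
apply: eq_bigr => j _; case: ltnP => [_|/bin_small->].
  rewrite /trimon !exprMn mulrnAr -mulrnA mulnC [RHS]mulr_natl; congr (_ *+ _).
  move: (p ^+ _) (q ^+ _) (r ^+ _) (p' ^+ _) (q' ^+ _) (r' ^+ _) => *; ring.
by rewrite muln0 mul0r mulr0 mul0rn.
Qed.

Variables m n : nat.

(* The exponents of (x_1, x_0, x_2) are (m - k, k - j, j) and those of
   (y_1, y_2, y_0) are (n - k', k' - j', j'). The monomials that are not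
   divisible by x_1 y_1 are a basis of the functions on the cone x.y = 0. *)
Local Notation T := ('I_m.+1 * 'I_m.+1 * ('I_n.+1 * 'I_n.+1))%type.
Implicit Types (x y : 'I_3 -> F) (t : T).

Definition bimon x y k j k' j' :=
  trimon m (x 1) (x 0) (x 2) k j * trimon n (y 1) (y 2) (y 0) k' j'.

Definition mon x y t := bimon x y t.1.1 t.1.2 t.2.1 t.2.2.

Definition valid t := (t.1.2 <= t.1.1)%N && (t.2.2 <= t.2.1)%N.

Definition standard t :=
  valid t && ((t.1.1 == m :> nat) || (t.2.1 == n :> nat)).

Definition multinom2 t : nat :=
  'C(m, t.1.1) * 'C(t.1.1, t.1.2) * ('C(n, t.2.1) * 'C(t.2.1, t.2.2)).

Lemma multinom2_gt0 t : valid t -> (0 < multinom2 t)%N.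
Proof.
move=> /andP[le1 le2].
by rewrite !muln_gt0 !bin_gt0 le1 le2 -ltnS ltn_ord -ltnS ltn_ord.
Qed.

Lemma multinom2_eq0 t : ~~ valid t -> multinom2 t = 0%N.
Proof.
rewrite negb_and -!ltnNge /multinom2 => /orP[] /bin_small->.
  by rewrite muln0.
by rewrite !muln0.
Qed.

Lemma binomial_product x y x' y' :
  (\sum_i x i * x' i) ^+ m * (\sum_i y i * y' i) ^+ n =
  \sum_t (multinom2 t)%:R * (mon x y t * mon x' y' t).
Proof.
have -> : \sum_i x i * x' i = x 1 * x' 1 + (x 0 * x' 0 + x 2 * x' 2).
  by rewrite sum3E; ring.
have -> : \sum_i y i * y' i = y 1 * y' 1 + (y 2 * y' 2 + y 0 * y' 0).
  by rewrite sum3E; ring.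
rewrite !trinomial !pair_bigA big_distrlr pair_bigA; apply: eq_bigr => t _ /=.
rewrite /mon /bimon /multinom2 [in RHS]natrM mulrACA.
by congr (_ * _); rewrite mulrACA.
Qed.

Lemma monM x y x' y' t :
  mon (fun i => x i * x' i) (fun i => y i * y' i) t = mon x y t * mon x' y' t.
Proof.
rewrite /mon /bimon /trimon /= !exprMn.
move: (x 1 ^+ _) (x 0 ^+ _) (x 2 ^+ _) (x' 1 ^+ _) (x' 0 ^+ _) (x' 2 ^+ _)
  (y 1 ^+ _) (y 0 ^+ _) (y 2 ^+ _) (y' 1 ^+ _) (y' 0 ^+ _) (y' 2 ^+ _) => *; ring.
Qed.

(** Lower unipotents parametrise cone points x = (1, a, b), y = (e, -(e + b)/a, 1). Powers of a
    isolate (k, k') by [standard_exponent]; after division by a power of -(e + b), powers of e and b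
    isolate j' and j. *)
Lemma standard_indep (c : T -> F) :
  (forall t, ~~ standard t -> c t = 0) ->
  (forall B : SL3 F, \sum_t c t * mon (fun i => B i 0) (invmx B 2) t = 0) ->
  forall t, c t = 0.
Proof.
move=> cstd c0 t0; have [std0|/cstd//] := boolP (standard t0).
case/andP: (std0) => _ std0'.
have eq1 (b e : F) : \sum_(t : T | (m - t.1.1 + t.2.1 == m - t0.1.1 + t0.2.1)%N)
    c t * ((- (e + b)) ^+ (n - t.2.1) * b ^+ t.1.2 * e ^+ t.2.2) = 0.
  apply: (@poly_fun_coef0 _ _ predT _ _ 0) => a nz_a.
  (* The third parameter (e + b)/a turns the corner entry a c - b of the inverse into e; the factor
     a^n clears the denominator a^(n-k'). *)
  have /(congr1 ( *%R (a ^+ n))) := c0 (low a b ((e + b) / a)).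
  rewrite mulr0 => E; apply: etrans E; rewrite mulr_sumr.
  apply: eq_bigr => t _; rewrite [RHS]mulrCA -[LHS]mulrA; congr (_ * _).
  rewrite /mon /bimon /trimon -SL3_invE low_inv !mxE /=.
  have -> : a * ((e + b) / a) - b = e by field.
  rewrite !expr1n !mulr1 exprD.
  have -> : a ^+ n = a ^+ t.2.1 * a ^+ (n - t.2.1).
    by rewrite -exprD subnKC // -ltnS.
  rewrite -mulNr exprMn exprVn.
  move: (expf_neq0 (n - t.2.1) nz_a).
  move: (a ^+ _) (a ^+ (n - _)) (a ^+ (m - _)) ((- _) ^+ _) (b ^+ _) (e ^+ _).
  by move=> *; field.
have eq2 (b e : F) : e != - b ->
    \sum_(t : T | (t.1.1 == t0.1.1) && (t.2.1 == t0.2.1))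
      c t * b ^+ t.1.2 * e ^+ t.2.2 = 0.
  move=> nz_eb.
  have nz_p : (- (e + b)) ^+ (n - t0.2.1) != 0.
    by rewrite expf_neq0 // oppr_eq0 addr_eq0.
  apply: (mulfI nz_p); rewrite mulr0; apply: etrans (eq1 b e); rewrite mulr_sumr.
  rewrite big_mkcond [RHS]big_mkcond; apply: eq_bigr => t _.
  have [stdt|/cstd->] := boolP (standard t); last by rewrite !mul0r mulr0 !if_same.
  have -> : (m - t.1.1 + t.2.1 == m - t0.1.1 + t0.2.1)%N =
      (t.1.1 == t0.1.1) && (t.2.1 == t0.2.1).
    by case/andP: stdt => _ stdt; rewrite (@standard_exponent m n) ?leq_ord.
  by case: andP => // -[_ /eqP->]; rewrite -(mulrA (c t)) mulrCA !mulrA.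
have eq3 := poly_fun_coef0 t0.2.2 (eq2 _).
have /(poly_fun_coef0 t0.1.2) : forall b : F, b != 0 -> 
    \sum_(t : T | (t.1.1 == t0.1.1) && (t.2.1 == t0.2.1) && (t.2.2 == t0.2.2 :> nat))
      c t * b ^+ t.1.2 = 0 by move=> b _; apply: eq3.
rewrite (big_pred1 t0) // => -[[k j] [k' j']] /=.
case: t0 {std0 std0' eq1 eq2 eq3} => [[k0 j0] [k0' j0']] /=.
by rewrite !xpair_eqE !val_eqE; do !case: (_ == _).
Qed.

(** Induction on m - k: a monomial that is not standard contains x_1 y_1, and replacing this by -
    (x_0 y_0 + x_2 y_2) raises k and k' by one in both terms. *)
Lemma straighten k j k' j' : (j <= k <= m)%N -> (j' <= k' <= n)%N ->
  exists r : T -> F, [/\ forall t, r t \is Num.real,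
    forall t, ~~ standard t -> r t = 0
    & forall x y, \sum_i x i * y i = 0 ->
        bimon x y k j k' j' = \sum_t r t * mon x y t].
Proof.
have [N leN] := ubnP (m - k); elim: N k j k' j' leN => // N IHN k j k' j' leN.
move=> /andP[jk km] /andP[jk' kn'].
have [std|] := boolP ((k == m) || (k' == n)).
  pose t0 : T := ((inord k, inord j), (inord k', inord j')).
  have val0 : [/\ t0.1.1 = k :> nat, t0.1.2 = j :> nat, t0.2.1 = k' :> nat
                & t0.2.2 = j' :> nat].
    by split; rewrite inordK // ltnS // ?(leq_trans jk) ?(leq_trans jk').
  have std0 : standard t0.
    by case: val0 => e1 e2 e3 e4; rewrite /standard /valid e1 e2 e3 e4 jk jk'.
  exists (fun t => (t == t0)%:R); split=> [t|t|x y _].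
  - exact: realn.
  - by apply: contraNeq; rewrite pnatr_eq0 eqb0 negbK => /eqP->.
  - rewrite (bigD1 t0) //= eqxx mul1r big1 ?addr0 => [|t /negPf->]; last first.
      by rewrite mul0r.
    by case: val0 => e1 e2 e3 e4; rewrite /mon e1 e2 e3 e4.
rewrite negb_or => /andP[nk nk'].
have ltk : (k < m)%N by rewrite ltn_neqAle nk.
have ltk' : (k' < n)%N by rewrite ltn_neqAle nk'.
have ltN : (m - k.+1 < N)%N by rewrite -ltnS subnSK.
(* [r1] treats the term with x_0 y_0, which also raises j'; [r2] treats the term with x_2 y_2, which
   also raises j. *)
have [r1 [real1 std1 E1]] : exists r : T -> F, [/\ forall t, r t \is Num.real,
    forall t, ~~ standard t -> r t = 0
    & forall x y, \sum_i x i * y i = 0 ->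
        bimon x y k.+1 j k'.+1 j'.+1 = \sum_t r t * mon x y t].
  by apply: IHN; rewrite // ?ltk ?ltk' ?ltnS ?(leqW jk) ?jk'.
have [r2 [real2 std2 E2]] : exists r : T -> F, [/\ forall t, r t \is Num.real,
    forall t, ~~ standard t -> r t = 0
    & forall x y, \sum_i x i * y i = 0 ->
        bimon x y k.+1 j.+1 k'.+1 j' = \sum_t r t * mon x y t].
  by apply: IHN; rewrite // ?ltk ?ltk' ?ltnS ?(leqW jk') ?jk.
exists (fun t => - (r1 t + r2 t)); split=> [t|t nstd|x y xy0].
- by rewrite rpredN rpredD.
- by rewrite std1 // std2 // addr0 oppr0.
have -> : \sum_t - (r1 t + r2 t) * mon x y t =
    - (\sum_t r1 t * mon x y t + \sum_t r2 t * mon x y t).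
  by rewrite -big_split -sumrN; apply: eq_bigr => t _ /=; rewrite mulNr mulrDl.
rewrite -E1 // -E2 // /bimon /trimon.
rewrite -(subnSK ltk) -(subnSK ltk') !subSS !subSn // !exprS.
apply/eqP; rewrite -subr_eq0 -[X in _ == X](mul0r (x 1 ^+ (m - k.+1) *
  x 0 ^+ (k - j) * x 2 ^+ j * (y 1 ^+ (n - k'.+1) * y 2 ^+ (k' - j') * y 0 ^+ j'))).
rewrite -xy0 sum3E; apply/eqP.
move: (x 1 ^+ _) (x 0 ^+ _) (x 2 ^+ _) (y 1 ^+ _) (y 0 ^+ _) (y 2 ^+ _) => *; ring.
Qed.
End Monomials.

(** * The Gram matrix of the standard monomials and the trace on the torus *)

Section TorusTrace.
Variables (F : numClosedFieldType) (m n : nat).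

Local Notation T := ('I_m.+1 * 'I_m.+1 * ('I_n.+1 * 'I_n.+1))%type.
Implicit Type t : T.

Definition std_mons : {set T} := [set t | standard t].
Local Notation N := #|std_mons|.

Lemma sum_std (V : nmodType) (f : T -> V) : (forall t, ~~ standard t -> f t = 0) ->
  \sum_t f t = \sum_(i < N) f (enum_val i).
Proof.
move=> f0; rewrite -big_enum_val [RHS]big_mkcond; apply: eq_bigr => t _.
by rewrite inE; case: ifPn => // /f0.
Qed.

Lemma standard_enum_val (i : 'I_N) : standard (enum_val i).
Proof. by have := enum_valP i; rewrite inE. Qed.

Lemma SL3_cone (B : SL3 F) : \sum_i B i 0 * invmx B 2 i = 0.
Proof.
transitivity ((invmx B *m B) 2 0); last by rewrite SL3_mulVmx mxE.
by rewrite mxE; apply: eq_bigr => i _; rewrite mulrC.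
Qed.

Definition tr_SL3 (B : SL3 F) : SL3 F := mkSL3 (etrans (det_tr B) (SL3_det B)).

Lemma mon_tr_SL3 (B : SL3 F) t :
  mon (tr_SL3 B 0) (fun i => invmx (tr_SL3 B) i 2) t =
  mon (fun i => B i 0) (invmx B 2) t.
Proof. by rewrite /mon /bimon /= -trmx_inv !mxE. Qed.

Lemma straightening_matrix : exists R : T -> T -> F,
  [/\ forall t s, R t s \is Num.real, forall t s, ~~ standard s -> R t s = 0,
      forall t, valid t -> forall x y, \sum_i x i * y i = 0 ->
        mon x y t = \sum_s R t s * mon x y s
    & forall t s, standard t -> R t s = (s == t)%:R].
Proof.
have [R RP] : exists R : T -> T -> F, forall t,
    [/\ forall s, R t s \is Num.real, forall s, ~~ standard s -> R t s = 0
      & valid t -> forall x y, \sum_i x i * y i = 0 ->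
          mon x y t = \sum_s R t s * mon x y s].
  apply: (fin_all_exists (P := fun (t : T) (r : T -> F) =>
    [/\ forall s, r s \is Num.real, forall s, ~~ standard s -> r s = 0
      & valid t -> forall x y, \sum_i x i * y i = 0 ->
          mon x y t = \sum_s r s * mon x y s])) => t.
  have [/andP[v1 v2]|] := boolP (valid t).
    have [||r [real_r std_r rE]] := @straighten F m n t.1.1 t.1.2 t.2.1 t.2.2.
    - by rewrite v1 leq_ord.
    - by rewrite v2 leq_ord.
    by exists r; split.
  by exists (fun=> 0); split=> // s; apply: real0.
have R0 t s : ~~ standard s -> R t s = 0 by case: (RP t) => _ + _; apply.
have RE t : valid t -> forall x y, \sum_i x i * y i = 0 ->
  mon x y t = \sum_s R t s * mon x y s by case: (RP t).
exists R; split=> // [t s|t s std_t]; first by case: (RP t).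
(* A standard monomial is its own expansion, and independence makes the expansion unique. *)
apply/eqP; rewrite -subr_eq0; apply/eqP; move: s.
apply: standard_indep => [s nstd|B].
  rewrite R0 // sub0r; case: eqP => [st|_]; last by rewrite oppr0.
  by rewrite st std_t in nstd.
transitivity (\sum_s R t s * mon (fun i => B i 0) (invmx B 2) s -
    \sum_s (s == t)%:R * mon (fun i => B i 0) (invmx B 2) s).
  by rewrite -sumrB; apply: eq_bigr => s _; rewrite mulrBl.
rewrite -RE; first 1 last.
- by case/andP: std_t.
- exact: SL3_cone.
rewrite (bigD1 t) //= eqxx mul1r big1 ?addr0 ?subrr // => s /negPf->.
by rewrite mul0r.
Qed.

(* The Gram matrix is R^T C R with R the real straightening matrix and C the
   diagonal matrix of the multinomial coefficients: it is positive definite. *)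
Lemma standard_gram : exists2 G : 'M[F]_N, G \in unitmx &
  forall x y x' y', \sum_i x i * y i = 0 -> \sum_i x' i * y' i = 0 ->
    (\sum_i x i * x' i) ^+ m * (\sum_i y i * y' i) ^+ n =
    ((\row_i mon x y (enum_val i)) *m G *m \col_i mon x' y' (enum_val i)) 0 0.
Proof.
have [R [Rreal R0 RE Rstd]] := straightening_matrix.
pose Rm t : 'cV[F]_N := \col_i R t (enum_val i).
pose G := \sum_t (multinom2 t)%:R *: (Rm t *m (Rm t)^T).
exists G.
  rewrite -row_free_unit -kermx_eq0; apply/eqP/row_matrixP => i0; rewrite row0.
  set u := row i0 _; have uG : u *m G = 0 by rewrite -row_mul mulmx_ker row0.
  pose w t := (u *m Rm t) 0 0.
  (* R being real, this sum of nonnegative terms is u G u^* = 0, so w vanishes at every valid t. At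
     a standard t the row of R is a unit vector and w t is an entry of u. *)
  have sum0 : \sum_t (multinom2 t)%:R * `|w t| ^+ 2 = 0.
    transitivity ((u *m G *m (map_mx Num.conj u)^T) 0 0); last first.
      by rewrite uG mul0mx mxE.
    rewrite mulmx_sumr mulmx_suml summxE; apply: eq_bigr => t _.
    rewrite -scalemxAr -scalemxAl mxE; congr (_ * _).
    rewrite normCK -!mulmxA mulmxA mxE big_ord1; congr (_ * _).
    rewrite /w !mxE rmorph_sum; apply: eq_bigr => i _.
    by rewrite !mxE rmorphM /= (CrealP (Rreal _ _)) mulrC.
  have w0 t : valid t -> w t = 0.
    move=> vt; have /eqP := sum0.
    rewrite psumr_eq0 => [/allP/(_ t (mem_index_enum t))/implyP/(_ isT)|s _].
      rewrite mulf_eq0 pnatr_eq0 eqn0Ngt multinom2_gt0 //=.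
      by rewrite expf_eq0 normr_eq0 => /eqP.
    by rewrite mulr_ge0 ?ler0n ?exprn_ge0.
  apply/rowP => i; rewrite [RHS]mxE.
  have stdi := standard_enum_val i.
  have vali : valid (enum_val i) by case/andP: stdi.
  apply: etrans (w0 _ vali).
  rewrite /w [RHS]mxE (bigD1 i) //= [Rm _ _ _]mxE Rstd // eqxx mulr1 big1 ?addr0 // => j ji.
  by rewrite [Rm _ _ _]mxE Rstd // (inj_eq enum_val_inj) (negPf ji) mulr0.
move=> x y x' y' xy0 xy0'; rewrite binomial_product.
rewrite mulmx_sumr mulmx_suml summxE; apply: eq_bigr => t _.
rewrite -scalemxAr -scalemxAl mxE; have [vt|/multinom2_eq0->] := boolP (valid t).
  congr (_ * _); rewrite -!mulmxA mulmxA mxE big_ord1 !RE //.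
  rewrite !sum_std => [|s /R0->|s /R0->]; rewrite ?mul0r //.
  by congr (_ * _); rewrite mxE; apply: eq_bigr => i _; rewrite !mxE // mulrC.
by rewrite !mul0r.
Qed.

Variables (d : nat) (rho : SL3_representation F d).
Hypothesis irr_rho : SL3_irreducible rho.
Hypothesis hw_rho : has_highest_weight rho m n.

(** By [standard_gram] the matrix coefficient at A B factors as a(A) G b(B), with a and b listing
    standard monomials. Left multiplication by D scales each entry of b by its weight, so
    [matrix_coefficient_trace] sums the weights. *)
Lemma torus_trace (D : SL3 F) : is_diag_mx D ->
  \tr (rho D) =
  \sum_(t : T | standard t) mon (fun i => D i i) (fun i => (D i i)^-1) t.
Proof.
move=> /is_diag_mxP diagD.
have D0 i j : i != j -> D i j = 0 by move=> ij; apply: diagD.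
have [v [nz_v unip_v tor_v]] := hw_rho.
have [l lE] := highest_weight_functional nz_v unip_v tor_v.
have [G unitG GE] := standard_gram.
pose b (B : SL3 F) : 'cV[F]_N :=
  \col_i mon (fun i => B i 0) (invmx B 2) (enum_val i).
pose a (A : SL3 F) : 'rV[F]_N :=
  \row_i mon (A 0) (fun i => invmx A i 2) (enum_val i).
have b_indep (c : 'rV_N) : (forall B, c *m b B = 0) -> c = 0.
  move=> cb0; pose c' t := \sum_(i < N | enum_val i == t) c 0 i.
  have c'E i : c' (enum_val i) = c 0 i.
    by rewrite /c' (big_pred1 i) // => j; rewrite /= (inj_eq enum_val_inj).
  apply/rowP => i; rewrite -c'E mxE; apply: standard_indep => [t nstd|B].
    rewrite /c' big_pred0 // => j; apply: contraNF nstd => /eqP <-.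
    exact: standard_enum_val.
  have c'0 t : ~~ standard t -> c' t = 0.
    move=> nstd; rewrite /c' big_pred0 // => j; apply: contraNF nstd => /eqP <-.
    exact: standard_enum_val.
  rewrite sum_std => [|t /c'0->]; last by rewrite mul0r.
  have /matrixP/(_ 0 0) := cb0 B; rewrite !mxE; apply: etrans.
  by apply: eq_bigr => j _; rewrite c'E mxE.
(* Transposition exchanges the two sides: a at [tr_SL3 B] is the transpose of b at B. *)
have a_indep (c : 'cV_N) : (forall A, a A *m c = 0) -> c = 0.
  move=> ac0; apply: trmx_inj; rewrite trmx0; apply: b_indep => B.
  apply: trmx_inj; rewrite trmx_mul trmxK trmx0; apply: etrans (ac0 (tr_SL3 B)).
  by congr (_ *m c); apply/rowP => i; rewrite !mxE mon_tr_SL3.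
have DVE i : invmx D i i = (D i i)^-1.
  have := congr1 (fun M : 'M_3 => M i i) (SL3_mulmxV D).
  rewrite !mxE eqxx (bigD1 i) //= big1 ?addr0 => [DD|j ji]; last first.
    by rewrite D0 ?mul0r // eq_sym.
  have nzD : D i i != 0.
    by apply/eqP => D00; move/eqP: DD; rewrite D00 mul0r eq_sym oner_eq0.
  by apply: (mulfI nzD); rewrite DD divff.
have DV0 i j : i != j -> invmx D i j = 0.
  move=> ij; have := congr1 (fun M : 'M_3 => M i j) (SL3_mulmxV D).
  rewrite !mxE (negPf ij) (bigD1 i) //= big1 ?addr0 => [/eqP|k ki]; last first.
    by rewrite D0 ?mul0r // eq_sym.
  rewrite mulf_eq0 => /orP[/eqP Di|/eqP //].
  have := congr1 (fun M : 'M_3 => M i i) (SL3_mulmxV D).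
  rewrite !mxE eqxx (bigD1 i) //= big1 ?addr0 => [/eqP|k ki]; last first.
    by rewrite D0 ?mul0r // eq_sym.
  by rewrite Di mul0r eq_sym oner_eq0.
have nz_l : l != 0.
  apply/eqP => l0; have /eqP := lE 1%g.
  rewrite l0 mul0mx mxE -SL3_invE invg1 !mxE !eqxx !expr1n mulr1.
  by rewrite eq_sym oner_eq0.
pose w : 'rV[F]_N := \row_i mon (fun i => D i i) (fun i => (D i i)^-1) (enum_val i).
rewrite (@matrix_coefficient_trace F d rho irr_rho v l N a G b nz_v nz_l
  _ unitG a_indep b_indep D w).
- transitivity (\sum_(t in std_mons) mon (fun i => D i i) (fun i => (D i i)^-1) t).
    by rewrite [RHS]big_enum_val; apply: eq_bigr => i _; rewrite mxE.
  by apply: eq_bigl => t; rewrite inE.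
- move=> A B; apply/matrixP => i j; rewrite !ord1 lE -GE ?SL3_cone //.
    by rewrite -SL3_invE invMg !mxE; congr (_ ^+ _ * _ ^+ _); apply: eq_bigr => k _;
      rewrite // mulrC.
  have := congr1 (fun M : 'M_3 => M 0 2) (SL3_mulmxV A); rewrite !mxE //.
- move=> B; apply/colP => i; rewrite mul_diag_mx !mxE -monM.
  congr (mon _ _ _); apply/funext => k.
    rewrite mxE (bigD1 k) //= big1 ?addr0 // => j jk.
    by rewrite D0 ?mul0r // eq_sym.
  rewrite -SL3_invE invMg mxE (bigD1 k) //= big1 ?addr0 => [|j jk].
    by rewrite DVE mulrC.
  by rewrite DV0 ?mulr0.
Qed.
End TorusTrace.

(** * Generating functions *)

Section CompleteSymmetric.
Variable F : fieldType.

(** The coefficients of the series of u divided by 1 - p X. *)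
Definition geom_conv (p : F) (u : nat -> F) N := \sum_(k < N.+1) p ^+ (N - k) * u k.

Lemma geom_conv0 p u : geom_conv p u 0 = u 0%N.
Proof. by rewrite /geom_conv big_ord1 mul1r. Qed.

Lemma geom_convS p u N : geom_conv p u N.+1 = p * geom_conv p u N + u N.+1.
Proof.
rewrite /geom_conv big_ord_recr /= subnn mul1r mulr_sumr; congr (_ + _).
by apply: eq_bigr => k _; rewrite subSn ?leq_ord // exprS mulrA.
Qed.

(** The complete homogeneous symmetric polynomial in three variables, of degree the remaining
    argument. *)
Definition hsym (p q r : F) := geom_conv p (geom_conv q (fun k => r ^+ k)).

(** Congruence modulo X^(N+1), standing in for identities of power series. *)
Definition agree N (p q : {poly F}) := forall a, (a <= N)%N -> p`_a = q`_a.

Lemma agree_geom_conv N p u :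
  agree N ((1 - p *: 'X) * \poly_(a < N.+1) geom_conv p u a) (\poly_(a < N.+1) u a).
Proof.
move=> a aN; rewrite mulrBl mul1r coefB -scalerAl coefZ coefXM !coef_poly !ltnS aN.
case: a aN => [|a] aN /=; first by rewrite mulr0 subr0 geom_conv0.
by rewrite (ltnW aN) geom_convS addrC addKr.
Qed.

Lemma agree_trans N p q r : agree N p q -> agree N q r -> agree N p r.
Proof. by move=> pq qr a aN; rewrite pq ?qr. Qed.

Lemma agreeM N p p' q q' :
  agree N p p' -> agree N q q' -> agree N (p * q) (p' * q').
Proof.
move=> pp qq a aN; rewrite !coefM; apply: eq_bigr => i _.
by rewrite pp ?qq // ?(leq_trans (leq_subr _ _)) // (leq_trans (leq_ord i)).
Qed.

Definition den3 (d1 d2 : F) : {poly F} := 1 - d1 *: 'X + d2 *: 'X^2 - 'X^3.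

(** Since p q r = 1, the cubic is (1 - p X)(1 - q X)(1 - r X). Each factor undoes one [geom_conv],
    the powers r^k being the convolution of the unit sequence. *)
Lemma agree_hsym N p q r : p * q * r = 1 ->
  agree N (den3 (p + q + r) (p * q + q * r + p * r) * \poly_(a < N.+1) hsym p q r a) 1.
Proof.
move=> pqr; have -> : den3 (p + q + r) (p * q + q * r + p * r) =
    (1 - r *: 'X) * ((1 - q *: 'X) * (1 - p *: 'X)).
  rewrite /den3 -!mul_polyC !(polyCD, polyCM).
  have E : p%:P * q%:P * r%:P = 1 :> {poly F} by rewrite -!polyCM pqr.
  have -> : 'X^3 = p%:P * q%:P * r%:P * 'X^3 :> {poly F} by rewrite E mul1r.
  by ring.
have step1 := @agree_geom_conv N p (geom_conv q (fun k => r ^+ k)).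
have step2 := @agree_geom_conv N q (fun k => r ^+ k).
have step3 := @agree_geom_conv N r (fun k => (k == 0)%:R).
have rE k : geom_conv r (fun k => (k == 0)%:R) k = r ^+ k.
  elim: k => [|k IHk]; first by rewrite geom_conv0.
  by rewrite geom_convS IHk addr0 exprS.
have refl p' : agree N p' p' by [].
rewrite -!mulrA; apply: agree_trans (_ : agree N (\poly_(a < N.+1) (a == 0)%:R) 1).
  apply: agree_trans step3; apply: agreeM => //.
  apply: agree_trans (agreeM (refl _) step1) _; apply: agree_trans step2 _.
  by move=> a aN; rewrite !coef_poly rE.
by move=> a aN; rewrite coef_poly ltnS aN coefC; case: eqP.
Qed.

End CompleteSymmetric.

(** Standard monomials are all those of bidegree (m, n) except the multiples of x_1 y_1. The full
    sum is h_m h_n, and the multiples contribute x_1 y_1 h_(m-1) h_(n-1). *)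
Lemma sum_standard_mon (F : numClosedFieldType) m n (x y : 'I_3 -> F) :
  \sum_(t : 'I_m.+1 * 'I_m.+1 * ('I_n.+1 * 'I_n.+1) | standard t) mon x y t =
  hsym (x 1) (x 0) (x 2) m * hsym (y 1) (y 2) (y 0) n
  - (if (m, n) is (m'.+1, n'.+1) then
       x 1 * y 1 * (hsym (x 1) (x 0) (x 2) m' * hsym (y 1) (y 2) (y 0) n') else 0).
Proof.
(* The bound K = N + 1 gives h_N, while K = N keeps the multiples of p, which sum to p h_(N-1). *)
pose V N (p q r : F) K := \sum_(kj : 'I_N.+1 * 'I_N.+1 | (kj.1 < K)%N && (kj.2 <= kj.1)%N)
  trimon N p q r kj.1 kj.2.
have VE N p q r K : (K <= N.+1)%N ->
    V N p q r K = \sum_(k < K) p ^+ (N - k) * geom_conv q (fun k => r ^+ k) k.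
  move=> KN; rewrite (big_ord_widen N.+1
    (fun k => p ^+ (N - k) * geom_conv q (fun k => r ^+ k) k)) //.
  transitivity (\sum_(k < N.+1 | (k < K)%N) \sum_(j < N.+1 | (j <= k)%N)
      trimon N p q r k j); first by rewrite pair_big_dep.
  apply: eq_bigr => k _; rewrite /geom_conv mulr_sumr.
  rewrite (big_ord_widen N.+1 (fun j => p ^+ (N - k) * (q ^+ (k - j) * r ^+ j))) //.
  by apply: eq_bigr => j _; rewrite /trimon mulrA.
have Vfull N p q r : V N p q r N.+1 = hsym p q r N by rewrite VE.
have Vpart N p q r : V N p q r N = if N is N'.+1 then p * hsym p q r N' else 0.
  rewrite VE //; case: N => [|N]; first by rewrite big_ord0.
  rewrite /hsym {3}/geom_conv mulr_sumr; apply: eq_bigr => k _.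
  by rewrite subSn ?leq_ord // exprS mulrA.
have VV K K' : \sum_(t : 'I_m.+1 * 'I_m.+1 * ('I_n.+1 * 'I_n.+1) |
      ((t.1.1 < K)%N && (t.1.2 <= t.1.1)%N) && ((t.2.1 < K')%N && (t.2.2 <= t.2.1)%N))
    mon x y t = V m (x 1) (x 0) (x 2) K * V n (y 1) (y 2) (y 0) K'.
  by rewrite /V big_distrlr pair_big.
apply/eqP; rewrite eq_sym subr_eq; apply/eqP.
transitivity (V m (x 1) (x 0) (x 2) m.+1 * V n (y 1) (y 2) (y 0) n.+1).
  by rewrite !Vfull.
rewrite -VV (bigID (fun t : 'I_m.+1 * 'I_m.+1 * ('I_n.+1 * 'I_n.+1) =>
  (t.1.1 < m)%N && (t.2.1 < n)%N)) addrC /=.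
congr (_ + _); last first.
  apply: eq_bigl => t; rewrite !ltn_ord /= /standard /valid negb_and -!leqNgt.
  by rewrite !eqn_leq !leq_ord.
transitivity (V m (x 1) (x 0) (x 2) m * V n (y 1) (y 2) (y 0) n).
  rewrite -VV; apply: eq_bigl => t; rewrite !ltn_ord /=.
  by case: (t.1.1 < m)%N; case: (t.2.1 < n)%N; rewrite ?andbF ?andbT.
rewrite !Vpart; case: (m) (n) => [|m'] [|n'] //=; rewrite ?mul0r ?mulr0 //.
by rewrite mulrACA.
Qed.

(** * Power series expansions of rational functions in two variables *)

Section Expansions.
Variable F : fieldType.
Implicit Types (p q : {poly {poly F}}) (s : nat -> nat -> F) (r : ratfun2 F).

Definition agree2 N p q :=
  forall a b, (a <= N)%N -> (b <= N)%N -> p`_b`_a = q`_b`_a.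

Lemma agree2_trans N p q p' : agree2 N p q -> agree2 N q p' -> agree2 N p p'.
Proof. by move=> pq qp' a b aN bN; rewrite pq ?qp'. Qed.

Lemma agree2D N p p' q q' :
  agree2 N p p' -> agree2 N q q' -> agree2 N (p + q) (p' + q').
Proof. by move=> pp qq a b aN bN; rewrite !coefD pp ?qq. Qed.

Lemma agree2M N p p' q q' :
  agree2 N p p' -> agree2 N q q' -> agree2 N (p * q) (p' * q').
Proof.
move=> pp qq a b aN bN; rewrite !coefM !coef_sum; apply: eq_bigr => j _.
rewrite !coefM; apply: eq_bigr => i _.
by rewrite pp ?qq // ?(leq_trans (leq_subr _ _)) // (leq_trans (leq_ord _)).
Qed.

Definition truncate N s : {poly {poly F}} :=
  \poly_(b < N.+1) \poly_(a < N.+1) s a b.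

Lemma coef_truncate N s a b : (a <= N)%N -> (b <= N)%N ->
  (truncate N s)`_b`_a = s a b.
Proof. by move=> aN bN; rewrite coef_poly ltnS bN coef_poly ltnS aN. Qed.

(** Truncating s turns the convolution identities into polynomial congruences, open to ring
    manipulations. *)
Lemma is_expansionP r s :
  is_expansion r s <->
  exists p q, [/\ q`_0`_0 != 0, r = tofrac p / tofrac q
                & forall N, agree2 N (q * truncate N s) p].
Proof.
have E q a b N : (a <= N)%N -> (b <= N)%N -> (q * truncate N s)`_b`_a =
    \sum_(i < a.+1) \sum_(j < b.+1) q`_j`_i * s (a - i)%N (b - j)%N.
  move=> aN bN; rewrite exchange_big coefM coef_sum; apply: eq_bigr => j _.
  rewrite coefM; apply: eq_bigr => i _.
  by rewrite coef_truncate // (leq_trans (leq_subr _ _)).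
split=> -[p [q [nz_q rE qs]]]; exists p, q; split=> //.
  by move=> N a b aN bN; rewrite E // qs.
by move=> m n; rewrite -(E _ _ _ (maxn m n)) ?qs ?leq_maxl ?leq_maxr.
Qed.

Lemma tofrac_neq0 q : q`_0`_0 != 0 -> tofrac q != 0.
Proof. by apply: contraNneq => /eqP; rewrite tofrac_eq0 => /eqP->; rewrite !coef0. Qed.

Lemma coef00M p q : (p * q)`_0`_0 = p`_0`_0 * q`_0`_0.
Proof. by rewrite !coef0M. Qed.

Lemma is_expansionD r1 r2 s1 s2 : is_expansion r1 s1 -> is_expansion r2 s2 ->
  is_expansion (r1 + r2) (fun m n => s1 m n + s2 m n).
Proof.
move=> /is_expansionP[p1 [q1 [nz1 r1E s1E]]] /is_expansionP[p2 [q2 [nz2 r2E s2E]]].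
apply/is_expansionP; exists (p1 * q2 + p2 * q1), (q1 * q2); split.
- by rewrite coef00M mulf_neq0.
- by rewrite r1E r2E addf_div ?tofrac_neq0 // rmorphD !rmorphM.
move=> N; apply: (@agree2_trans _ _ (q1 * truncate N s1 * q2 + q2 * truncate N s2 * q1)).
  move=> a b aN bN; congr ((_ : {poly {poly F}})`_b`_a).
  have -> : truncate N (fun m n => s1 m n + s2 m n) = truncate N s1 + truncate N s2.
    apply/polyP => j; rewrite coefD !coef_poly; case: ifP => _; last by rewrite addr0.
    by apply/polyP => i; rewrite coefD !coef_poly; case: ifP => _; rewrite ?addr0.
  by ring.
by apply: agree2D; apply: agree2M.
Qed.

Lemma is_expansionZ c r s : is_expansion r s ->
  is_expansion (ratcst c * r) (fun m n => c * s m n).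
Proof.
move=> /is_expansionP[p [q [nz rE sE]]].
apply/is_expansionP; exists (c%:P%:P * p), q; split=> //.
  by rewrite rE rmorphM mulrA.
move=> N; apply: (@agree2_trans _ _ (c%:P%:P * (q * truncate N s))); last first.
  by apply: agree2M.
move=> a b aN bN; congr ((_ : {poly {poly F}})`_b`_a).
have -> : truncate N (fun m n => c * s m n) = c%:P%:P * truncate N s.
  apply/polyP => j; rewrite coefCM !coef_poly; case: ifP => _; last by rewrite mulr0.
  by apply/polyP => i; rewrite coefCM !coef_poly; case: ifP => _; rewrite ?mulr0.
by ring.
Qed.

Lemma is_expansion0 : is_expansion 0 (fun _ _ => 0 : F).
Proof.
exists 0, 1; split; first by rewrite !coefC oner_neq0.
  by rewrite rmorph0 mul0r.
move=> m n; rewrite !coef0 big1 // => a _; rewrite big1 // => b _.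
by rewrite mulr0.
Qed.

Lemma is_expansion_sum I (e : seq I) (r : I -> ratfun2 F) (s : I -> nat -> nat -> F) :
  (forall i, is_expansion (r i) (s i)) ->
  is_expansion (\sum_(i <- e) r i) (fun m n => \sum_(i <- e) s i m n).
Proof.
move=> rs; elim: e => [|i e IHe].
  rewrite big_nil; have -> : (fun m n => \sum_(i <- [::]) s i m n) = fun _ _ => 0.
    by apply/funext => m; apply/funext => n; rewrite big_nil.
  exact: is_expansion0.
rewrite big_cons; have -> : (fun m n => \sum_(j <- i :: e) s j m n) =
    fun m n => s i m n + \sum_(j <- e) s j m n.
  by apply/funext => m; apply/funext => n; rewrite big_cons.
exact: is_expansionD.
Qed.

Lemma coef_split (p q : {poly F}) a b :
  (p%:P * map_poly polyC q)`_b`_a = p`_a * q`_b.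
Proof. by rewrite coefCM coef_map /= mulrC coefCM mulrC. Qed.

Lemma agree2_split N (p p' q q' : {poly F}) : agree N p p' -> agree N q q' ->
  agree2 N (p%:P * map_poly polyC q) (p'%:P * map_poly polyC q').
Proof. by move=> pp qq a b aN bN; rewrite !coef_split pp ?qq. Qed.

(** The denominator splits into a cubic in t and one in u, inverted by the generating series of the
    h_m and h_n; the numerator 1 - t u subtracts the shifted product. The second cubic has d1 and d2
    interchanged, as happens when the second triple consists of the inverses of the first. *)
Lemma is_expansion_f_rat (p q r p' q' r' d1 d2 : F) :
  p * q * r = 1 -> p' * q' * r' = 1 ->
  d1 = p + q + r -> d2 = p * q + q * r + p * r ->
  d2 = p' + q' + r' -> d1 = p' * q' + q' * r' + p' * r' ->
  is_expansion (f_rat d1 d2) (fun m n => hsym p q r m * hsym p' q' r' n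
    - (if (m, n) is (m'.+1, n'.+1) then hsym p q r m' * hsym p' q' r' n' else 0)).
Proof.
move=> e3 e3' d1E d2E d2E' d1E'; apply/is_expansionP.
pose Q := (den3 d1 d2)%:P * map_poly polyC (den3 d2 d1).
have QE : Q = (1 - 'X%:P * d1%:P%:P + 'X%:P ^+ 2 * d2%:P%:P - 'X%:P ^+ 3)
   * (1 - 'X * d2%:P%:P + 'X ^+ 2 * d1%:P%:P - 'X ^+ 3).
  rewrite /Q /den3; congr (_ * _).
    by rewrite -!mul_polyC !(polyCD, polyCM, polyCN, polyC_exp); ring.
  rewrite -!mul_polyC !(rmorphD, rmorphB, rmorphM, rmorphXn, rmorphN) /=.
  by rewrite !(map_polyC, map_polyX, rmorph1) /=; ring.
have tofracE := (tofrac1, tofracB, tofracD, tofracM, tofracXn).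
exists (1 - 'X%:P * 'X), Q; split.
- by rewrite coef_split /den3 !(coefB, coefD, coefZ, coefX, coefXn, coefC) /=
    !(mulr0, subr0, addr0) mulr1 oner_neq0.
- by rewrite QE /f_rat /rat_t /rat_u /ratcst !tofracE.
move=> N; set s := fun m n => _.
pose H := \poly_(a < N.+1) hsym p q r a; pose H' := \poly_(a < N.+1) hsym p' q' r' a.
have sE : agree2 N (truncate N s) ((1 - 'X%:P * 'X) * (H%:P * map_poly polyC H')).
  move=> a b aN bN; rewrite coef_truncate // mulrBl mul1r !coefB coef_split.
  rewrite -mulrA ['X * _]mulrC mulrA mulrA !coef_poly !ltnS aN bN /s; congr (_ - _).
  rewrite coefMX; case: b bN => [|b] bN /=; first by rewrite coef0; case: (a).
  rewrite -mulrA coefCM mulrC coefMX; case: a aN => [|a] aN //=.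
  by rewrite coef_split !coef_poly !ltnS (ltnW aN) (ltnW bN).
apply: (agree2_trans (agree2M (fun a b _ _ => erefl) sE)).
apply: (@agree2_trans _ _ ((1 - 'X%:P * 'X) *
   ((den3 d1 d2 * H)%:P * map_poly polyC (den3 d2 d1 * H')))).
  move=> a b _ _; congr ((_ : {poly {poly F}})`_b`_a).
  by rewrite /Q polyCM rmorphM; ring.
apply: (@agree2_trans _ _ ((1 - 'X%:P * 'X) * (1%:P * map_poly polyC 1))).
  apply: agree2M => //; apply: agree2_split.
    by rewrite d1E d2E; apply: agree_hsym.
  by rewrite d1E' d2E'; apply: agree_hsym.
by rewrite polyC1 rmorph1 !mulr1.
Qed.
End Expansions.

(** * Characters of finite groups *)

Section FiniteOrder.
Variable F : numClosedFieldType.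

(** The minimal polynomial divides X^k - 1, which splits and is separable in characteristic zero. *)
Lemma finite_order_diag n (A : 'M[F]_n.+1) k : (0 < k)%N -> A ^+ k = 1 ->
  exists P (e : 'rV_n.+1), [/\ P \in unitmx, P *m A = diag_mx e *m P
    & forall i, e 0 i ^+ k = 1].
Proof.
move=> k_gt0 Ak.
have [rs def_p] := closed_field_poly_normal ('X^k - 1 : {poly F}).
rewrite lead_coefXnsubC // scale1r in def_p.
have uniq_rs : uniq rs.
  by rewrite -separable_prod_XsubC -def_p separable_Xn_sub_1 // pnatr_eq0 -lt0n.
have [P unitP diagP] : diagonalizable A.
  apply/diagonalizableP; exists rs => //; rewrite -def_p; apply: mxminpoly_min.
  by rewrite rmorphB rmorphXn rmorph1 /= horner_mx_X Ak subrr.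
have /diag_mxP[e eP] : is_diag_mx (P *m A *m invmx P).
  by rewrite -conjumx.
have PA : P *m A = diag_mx e *m P by rewrite -eP mulmxKV.
exists P, e; split=> // i.
have PAj j : P *m A ^+ j = diag_mx (\row_i e 0 i ^+ j) *m P.
  elim: j => [|j IHj].
    rewrite expr0 mulmx1 -[LHS]mul1mx; congr (_ *m _); rewrite -diag_const_mx.
    by congr diag_mx; apply/rowP => l; rewrite !mxE expr0.
  rewrite exprSr [A ^+ j * A]/(A ^+ j *m A) mulmxA IHj -mulmxA PA mulmxA.
  congr (_ *m _); rewrite mulmx_diag; congr diag_mx; apply/rowP => l.
  by rewrite !mxE exprSr.
have := PAj k; rewrite Ak mulmx1 -[LHS]mul1mx => /(can_inj (mulmxK unitP)).
by move=> /matrixP/(_ i i); rewrite !mxE eqxx !mulr1n => <-.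
Qed.

Lemma root_unity_conj (z : F) k : (0 < k)%N -> z ^+ k = 1 -> z^* = z^-1.
Proof.
move=> k_gt0 zk; rewrite invC_norm; suff -> : `|z| = 1 by rewrite expr1n invr1 mul1r.
by apply/eqP; rewrite -(pexpr_eq1 k_gt0) ?normr_ge0 // -normrX zk normr1.
Qed.

(** The eigenvalues are roots of unity, whose inverses are their conjugates. *)
Lemma mxtrace_finite_order_inv n (A : 'M[F]_n.+1) k : (0 < k)%N -> A ^+ k = 1 ->
  \tr (invmx A) = (\tr A)^*.
Proof.
move=> k_gt0 Ak; have [P [e [unitP PA ek]]] := finite_order_diag k_gt0 Ak.
have AE : A = invmx P *m diag_mx e *m P by rewrite -mulmxA -PA mulKmx.
have nz_e i : e 0 i != 0.
  by apply: contra_eq_neq (ek i) => ->; rewrite expr0n gtn_eqF // eq_sym oner_neq0.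
pose B := invmx P *m diag_mx (\row_i (e 0 i)^-1) *m P.
have AB : A *m B = 1%:M.
  rewrite AE /B -!mulmxA mulKVmx // (mulmxA (diag_mx e)) mulmx_diag.
  have -> : \row_j (e 0 j * (\row_i (e 0 i)^-1) 0 j) = const_mx 1.
    by apply/rowP => j; rewrite !mxE divff.
  by rewrite diag_const_mx mul1mx mulVmx.
have -> : invmx A = B.
  have [unitA _] := mulmx1_unit AB.
  by rewrite -[B]mul1mx -(mulVmx unitA) -mulmxA AB mulmx1.
rewrite [in RHS]AE /B -!mulmxA !(mxtrace_mulC (invmx P)) -!mulmxA mulmxV // !mulmx1.
rewrite !mxtrace_diag rmorph_sum; apply: eq_bigr => i _.
by rewrite mxE /= (root_unity_conj k_gt0 (ek i)).
Qed.

Lemma SL3_finite_order_trace (z : SL3 F) k : (0 < k)%N -> (z : 'M_3) ^+ k = 1 ->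
  exists p q r : F, [/\ p * q * r = 1, \tr z = p + q + r,
    \tr (invmx z) = p^-1 + q^-1 + r^-1
    & forall m n d (rho : SL3_representation F d),
        SL3_irreducible rho -> has_highest_weight rho m n ->
        \tr (rho z) = hsym p q r m * hsym p^-1 r^-1 q^-1 n
          - (if (m, n) is (m'.+1, n'.+1) then
               hsym p q r m' * hsym p^-1 r^-1 q^-1 n' else 0)].
Proof.
move=> k_gt0 zk; have [P [e [unitP Pz ek]]] := finite_order_diag k_gt0 zk.
have nz_e i : e 0 i != 0.
  by apply: contra_eq_neq (ek i) => ->; rewrite expr0n gtn_eqF // eq_sym oner_neq0.
have nzP : \det P != 0 by rewrite -unitfE -unitmxE.
(* Rescaling one row gives the diagonalizing matrix determinant 1, so that the conjugation happens
   inside SL_3 and rho carries it over. *)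
pose c : 'rV[F]_3 := \row_i if i == 0 then (\det P)^-1 else 1.
have detP' : \det (diag_mx c *m P) = 1.
  by rewrite det_mulmx det_diag !big_ord_recl big_ord0 !mxE /= !mulr1 mulVf.
have detD : \det (diag_mx e) = 1.
  by apply: (mulIf nzP); rewrite -det_mulmx -Pz det_mulmx SL3_det mulr1 mul1r.
pose Q := mkSL3 detP'; pose D := mkSL3 detD.
have QzD : (Q * z)%g = (D * Q)%g.
  apply: val_inj; rewrite /= -mulmxA Pz !mulmxA !mulmx_diag.
  by congr (diag_mx _ *m _); apply/rowP => i; rewrite !mxE mulrC.
have zE : z = (Q^-1 * D * Q)%g by rewrite -mulgA -QzD mulKg.
have trE d (rho : SL3_representation F d) : \tr (rho z) = \tr (rho D).
  rewrite zE !SL3_reprM mxtrace_mulC mulmxA -SL3_reprM mulgV SL3_repr1.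
  by rewrite mul1mx.
have e1 : e 0 0 * e 0 1 * e 0 2 = 1.
  rewrite -[RHS]detD det_diag !big_ord_recl big_ord0 mulr1 mulrA.
  by congr (_ * e 0 _ * e 0 _); apply: val_inj.
(* This order matches the variables of the monomials: (x_1, x_0, x_2) for p, q, r and (y_1, y_2,
   y_0) for the inverses of p, r, q. *)
exists (e 0 1), (e 0 0), (e 0 2); split.
- by rewrite -[RHS]e1; ring.
- have -> : \tr z = \tr (diag_mx e).
    have <- : invmx P *m diag_mx e *m P = z by rewrite -mulmxA -Pz mulKmx.
    by rewrite -mulmxA mxtrace_mulC -mulmxA mulmxV // mulmx1.
  by rewrite mxtrace_diag sum3E; ring.
- rewrite (mxtrace_finite_order_inv k_gt0 zk).
  have -> : \tr z = \tr (diag_mx e).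
    have <- : invmx P *m diag_mx e *m P = z by rewrite -mulmxA -Pz mulKmx.
    by rewrite -mulmxA mxtrace_mulC -mulmxA mulmxV // mulmx1.
  rewrite mxtrace_diag sum3E !rmorphD /= !(root_unity_conj k_gt0 (ek _)).
  by rewrite [_^-1 + _^-1]addrC.
- move=> m n d rho irr_rho hw_rho; rewrite trE (torus_trace irr_rho hw_rho).
    rewrite sum_standard_mon !mxE !eqxx !mulr1n.
    by case: m n {hw_rho} => [|m] [|n] //=; rewrite ?mxE ?eqxx ?mulr1n divff // mul1r.
  by apply/is_diag_mxP => i j ij; rewrite mxE (negPf (ij : i != j)) mulr0n.
Qed.
End FiniteOrder.

(** * Schur's lemma and orthogonality of characters *)

Section Schur.
Variables (F : numClosedFieldType) (gT : finGroupType) (G : {group gT}).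

Lemma mxtrace_repr_inv n (rG : mx_representation F G n) x : x \in G ->
  \tr (rG x^-1%g) = (\tr (rG x))^*.
Proof.
move=> Gx; case: n rG => [|n] rG; first by rewrite /mxtrace !big_ord0 rmorph0.
rewrite repr_mxV // (@mxtrace_finite_order_inv _ _ _ #[x]%g) ?order_gt0 //.
by rewrite -repr_mxX // expg_order repr_mx1.
Qed.

Variables (n1 n2 : nat) (rG1 : mx_representation F G n1) (rG2 : mx_representation F G n2).
Hypotheses (irr1 : mx_irreducible rG1) (irr2 : mx_irreducible rG2).

(** Schur's lemma: the kernel and the image of S are submodules, so S is bijective. *)
Lemma mx_rsim_intertwiner (S : 'M_(n1, n2)) :
  (forall x, x \in G -> rG1 x *m S = S *m rG2 x) -> S != 0 -> mx_rsim rG1 rG2.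
Proof.
move=> homS nzS; have [_ max1] := (mx_irrP rG1).1 irr1.
have [_ max2] := (mx_irrP rG2).1 irr2.
have freeS : row_free S.
  rewrite -kermx_eq0; apply: contraNT nzS => nzk.
  have fullk : row_full (kermx S).
    apply: max1 nzk; apply/mxmoduleP => x Gx; apply/sub_kermxP.
    by rewrite -mulmxA homS // mulmxA mulmx_ker mul0mx.
  by apply/eqP; apply: (row_full_inj fullk); rewrite mulmx_ker mulmx0.
have fullS : row_full S.
  have : row_full <<S>>%MS.
    apply: max2; last by rewrite -mxrank_eq0 genmxE mxrank_eq0.
    apply/mxmoduleP => x Gx; rewrite (eqmxMr _ (genmxE S)) genmxE -homS //.
    exact: submxMl.
  by rewrite /row_full genmxE.
by exists S => //; rewrite -(eqP freeS) (eqP fullS).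
Qed.

Definition average (X : 'M[F]_(n1, n2)) : 'M_(n1, n2) :=
  \sum_(x in G) rG1 x^-1%g *m X *m rG2 x.

Lemma average_hom X y : y \in G -> rG1 y *m average X = average X *m rG2 y.
Proof.
move=> Gy; rewrite mulmx_sumr mulmx_suml (reindex_inj (mulIg y)) /=.
apply: eq_big => [x|x]; rewrite groupMr // => Gx.
rewrite !mulmxA -repr_mxM ?groupV ?groupM // invMg mulKVg -!mulmxA -repr_mxM //.
Qed.

(** This rests on tr(A) tr(B) = sum_(i,j) (A E_ij B)_ij for the matrix units E_ij. *)
Lemma sum_char_average :
  \sum_(x in G) \tr (rG1 x^-1%g) * \tr (rG2 x) =
  \sum_i \sum_j average (delta_mx i j) i j.
Proof.
under [RHS]eq_bigr do under eq_bigr do rewrite summxE.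
under [RHS]eq_bigr do rewrite exchange_big.
rewrite exchange_big; apply: eq_bigr => x _; rewrite big_distrlr.
apply: eq_bigr => i _; apply: eq_bigr => j _ /=.
rewrite -(mul_delta_mx (0 : 'I_1)) mulmxA -colE -mulmxA -rowE mxE big_ord1.
by rewrite !mxE.
Qed.

Lemma orthogonality_nsim : ~ mx_rsim rG1 rG2 ->
  \sum_(x in G) \tr (rG1 x^-1%g) * \tr (rG2 x) = 0.
Proof.
move=> nsim; rewrite sum_char_average big1 // => i _; rewrite big1 // => j _.
suff -> : average (delta_mx i j) = 0 by rewrite mxE.
apply/eqP; apply: contraT => nzS; case: nsim.
apply: mx_rsim_intertwiner nzS => x Gx; exact: average_hom.
Qed.
End Schur.

(** Over an algebraically closed field the average of E_ij is a scalar matrix, which its trace, |G|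
    if i = j and 0 otherwise, determines. *)
Lemma orthogonality_sim (F : numClosedFieldType) (gT : finGroupType)
    (G : {group gT}) n (rG : mx_representation F G n) : mx_irreducible rG ->
  \sum_(x in G) \tr (rG x^-1%g) * \tr (rG x) = #|G|%:R.
Proof.
move=> irr; rewrite sum_char_average.
have [n_gt0 _] := (mx_irrP rG).1 irr.
have nz_n : n%:R != 0 :> F by rewrite pnatr_eq0 -lt0n.
have absG := group_closure_closed_field irr.
have avE i j : average rG rG (delta_mx i j) = ((i == j)%:R * #|G|%:R / n%:R)%:M.
  have /is_scalar_mxP[a aE] : is_scalar_mx (average rG rG (delta_mx i j)).
    apply: (mx_abs_irr_cent_scalar absG); apply/centgmxP => x Gx.
    by rewrite average_hom.
  rewrite aE; congr (_%:M); apply: (mulIf nz_n); rewrite divfK //.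
  have <- : \tr (a%:M : 'M_n) = a * n%:R by rewrite mxtrace_scalar mulr_natr.
  rewrite -aE raddf_sum /=.
  under eq_bigr => x Gx.
    rewrite mxtrace_mulC mulmxA -repr_mxM ?groupV // mulgV repr_mx1 mul1mx.
    over.
  rewrite sumr_const mulr_natr; congr (_ *+ _).
  rewrite /mxtrace (bigD1 i) //= big1 => [|l li]; rewrite mxE.
    by rewrite eqxx addr0.
  by rewrite (negPf li).
transitivity (\sum_(i < n) \sum_(j < n) (i == j)%:R * (#|G|%:R / n%:R : F)).
  apply: eq_bigr => i _; apply: eq_bigr => j _; rewrite avE mxE.
  by case: eqP; rewrite ?mulr1n ?mul1r // mulr0n mul0r.
under eq_bigr => i _.
  rewrite (bigD1 i) //= eqxx mul1r big1 ?addr0; last first.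
    by move=> j /negPf ji; rewrite eq_sym ji mul0r.
  over.
by rewrite sumr_const card_ord -[LHS]mulr_natr divfK.
Qed.

Lemma mxtrace_rsim (F : fieldType) (gT : finGroupType) (G : {group gT}) n1 n2
    (rG1 : mx_representation F G n1) (rG2 : mx_representation F G n2) x :
  mx_rsim rG1 rG2 -> x \in G -> \tr (rG1 x) = \tr (rG2 x).
Proof.
case/mx_rsim_def=> f12 [f21] fK def_rG1 Gx.
by rewrite def_rG1 // mxtrace_mulC mulmxA fK mul1mx.
Qed.

Lemma mxtrace_dsum (F : fieldType) (gT : finGroupType) (G : {group gT}) I
    (e : seq I) (rG : I -> representation F G) x :
  \tr ((\big[dadd_grepr/grepr0]_(i <- e) rG i) x) = \sum_(i <- e) \tr (rG i x).
Proof.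
elim: e => [|i e IHe]; first by rewrite !big_nil /mxtrace big_ord0.
by rewrite !big_cons /= mxtrace_block IHe.
Qed.

Lemma mxtrace_decomposes_as (F : fieldType) (Gam : finSubgroupSL3 F) l
    (gam : 'I_l.+1 -> representation F [set: Gam]%G) n
    (rG : mx_representation F [set: Gam]%G n) (k : 'I_l.+1 -> nat) x :
  decomposes_as gam rG k -> \tr (rG x) = \sum_i (k i)%:R * \tr (gam i x).
Proof.
move=> /mxtrace_rsim-> //; rewrite mxtrace_dsum; apply: eq_bigr => i _.
by rewrite mxtrace_dsum sumr_const card_ord mulr_natl.
Qed.

(** * Inversion of the character table and diagonalization of the multiplicity matrices *)

Section CharacterTable.
Variables (F : numClosedFieldType) (Gam : finSubgroupSL3 F) (l : nat).
Variables (gam : 'I_l.+1 -> representation F [set: Gam]%G) (g : 'I_l.+1 -> Gam).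
Hypothesis gam_irr : irr_representatives gam.
Hypothesis g_classes : class_representatives g.

Local Notation T := (char_table gam g).
Local Notation cmx A := (map_mx (@Num.conj F) A).

Definition class_weight (j : 'I_l.+1) : F :=
  #|(g j ^: [set: Gam])%g|%:R / #|[set: Gam]|%:R.

Local Notation W := (diag_mx (\row_j class_weight j)).

Lemma sum_class_fun (f : Gam -> F) : (forall x y, f (x ^ y)%g = f x) ->
  \sum_x f x = \sum_j #|(g j ^: [set: Gam])%g|%:R * f (g j).
Proof.
move=> fJ.
transitivity (\sum_x \sum_(j | x \in (g j ^: [set: Gam])%g) f x).
  apply: eq_bigr => x _; have [j [xj uniq_j]] := g_classes x.
  rewrite (big_pred1 j) // => j'; apply/idP/eqP => [/uniq_j//|-> //].
rewrite (exchange_big_dep predT) //=; apply: eq_bigr => j _.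
rewrite (eq_bigr (fun=> f (g j))) => [|x /imsetP[y _ ->]]; last exact: fJ.
by rewrite sumr_const mulr_natl.
Qed.

Lemma char_orthogonality i j :
  \sum_x \tr (gam i x) * (\tr (gam j x))^* = (i == j)%:R * #|[set: Gam]|%:R.
Proof.
have [irr inj_gam _] := gam_irr.
transitivity (\sum_(x in [set: Gam]%G) \tr (gam j x^-1%g) * \tr (gam i x)).
  by apply: eq_big => [x|x _]; rewrite ?inE // mxtrace_repr_inv ?inE // mulrC.
have [->|/eqP ij] := eqVneq i j; first by rewrite orthogonality_sim // mul1r.
rewrite orthogonality_nsim // ?mul0r // => /inj_gam ji.
by rewrite ji in ij.
Qed.

Lemma char_table_orthogonality : T *m (W *m (cmx T)^T) = 1%:M.
Proof.
apply/matrixP => i j; rewrite mxE.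
have nzG : #|[set: Gam]|%:R != 0 :> F by rewrite pnatr_eq0 -lt0n cardG_gt0.
apply: (mulIf nzG); rewrite [in RHS]mxE -[RHS]char_orthogonality.
have trJ n (rG : mx_representation F [set: Gam]%G n) x y :
    \tr (rG (x ^ y)%g) = \tr (rG x).
  by rewrite conjgE !repr_mxM ?inE // mxtrace_mulC -mulmxA -repr_mxM ?inE //
    mulgV repr_mx1 mulmx1.
rewrite sum_class_fun => [|x y]; last by rewrite !trJ.
rewrite mulr_suml; apply: eq_bigr => k _.
rewrite mul_diag_mx !mxE /class_weight.
by field.
Qed.

Lemma char_table_unit : T \in unitmx.
Proof. by case: (mulmx1_unit char_table_orthogonality). Qed.

Lemma char_table_inv : invmx T = W *m (cmx T)^T.
Proof.
rewrite -[RHS]mul1mx -(mulVmx char_table_unit) -mulmxA.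
by rewrite char_table_orthogonality mulmx1.
Qed.

Lemma conj_class_weight j : (class_weight j)^* = class_weight j.
Proof. by rewrite /class_weight rmorphM fmorphV !rmorph_nat. Qed.

(* The transposed relation M^T T = T diag(c) and unitarity of T up to the real
   weights W give M = T diag(conj c) T^-1 for a real matrix M. *)
Lemma char_table_conj (k : nat) (M : 'M[F]_(l.+1, k)) (C : 'M[F]_(l.+1, k)) :
  cmx M = M -> M^T *m T = C^T -> M = T *m (W *m cmx C).
Proof.
move=> realM MT.
have MtE : M^T = C^T *m (W *m (cmx T)^T).
  by rewrite -MT -mulmxA char_table_orthogonality mulmx1.
have conjW : cmx W = W.
  by apply/matrixP => i j; rewrite !mxE rmorphMn /= conj_class_weight.
have conjK (a b : nat) (A : 'M[F]_(a, b)) : cmx (cmx A) = A.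
  by apply/matrixP => i j; rewrite !mxE conjCK.
rewrite -[LHS]realM -[M in LHS]trmxK MtE !trmx_mul !trmxK tr_diag_mx.
by rewrite !map_mxM conjK conjW mulmxA.
Qed.

(** The hypothesis says M^T T = T diag(c). Removing the transpose by [char_table_conj] conjugates c,
    so tensoring with a representation of character chi gives the conjugate eigenvalues. *)
Lemma mult_matrix_conj (A : 'I_l.+1 -> 'I_l.+1 -> nat) (c : 'I_l.+1 -> F) :
  (forall j k, \tr (gam j (g k)) * c k = \sum_i (A i j)%:R * \tr (gam i (g k))) ->
  invmx T *m (\matrix_(i, j) (A i j)%:R) *m T = diag_mx (\row_k (c k)^*).
Proof.
move=> Ac; set M := \matrix_(i, j) _.
have MT : M^T *m T = (diag_mx (\row_k c k) *m T^T)^T.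
  rewrite trmx_mul trmxK tr_diag_mx; apply/matrixP => j k.
  by rewrite mul_mx_diag !mxE Ac; apply: eq_bigr => i _; rewrite !mxE.
have realM : cmx M = M by apply/matrixP => i j; rewrite !mxE rmorph_nat.
have conjc : cmx (diag_mx (\row_k c k)) = diag_mx (\row_k (c k)^*).
  by apply/matrixP => i j; rewrite !mxE rmorphMn.
rewrite (char_table_conj realM MT) mulKmx ?char_table_unit // map_mxM conjc.
rewrite -map_trmx !mulmxA mulmx_diag -(mulmxA _ _ T).
have -> : \row_j ((\row_k class_weight k) 0 j * (\row_k (c k)^*) 0 j) =
    \row_j ((\row_k (c k)^*) 0 j * (\row_k class_weight k) 0 j).
  by apply/rowP => j; rewrite !mxE mulrC.
rewrite -mulmx_diag -mulmxA (mulmxA W) -char_table_inv mulVmx ?mulmx1 //.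
exact: char_table_unit.
Qed.

End CharacterTable.

(** * Assembly of the generating function *)

Section RatcstMorphism.
Variable F : fieldType.

(** The constants packaged as a ring morphism, so that matrix products and invertibility carry over
    to rational functions. *)
Definition ratcst_rmorphism : {rmorphism F -> ratfun2 F} :=
  (@tofrac {poly {poly F}} \o (polyC \o polyC)).

Lemma ratcstE c : ratcst c = ratcst_rmorphism c.
Proof. by []. Qed.

Lemma map_ratcst a b (A : 'M[F]_(a, b)) :
  map_mx (@ratcst F) A = map_mx ratcst_rmorphism A.
Proof. by []. Qed.
End RatcstMorphism.

Theorem mckay_generating_function (F : numClosedFieldType) (Gam : finSubgroupSL3 F) (l : nat)
    (gam : 'I_l.+1 -> representation F [set: Gam]%G)
    (g : 'I_l.+1 -> Gam)
    (A1 A2 : 'I_l.+1 -> 'I_l.+1 -> nat)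
    (d : nat -> nat -> nat)
    (pi : forall m n : nat, SL3_representation F (d m n))
    (mult : nat -> nat -> 'I_l.+1 -> nat)
    (gam_irr : irr_representatives gam)
    (gam0_triv : is_trivial_repr (gam ord0))
    (g_classes : class_representatives g)
    (A1_def : forall j, decomposes_as gam
       (prod_repr (gam j) (natural_repr Gam)) (fun i => A1 i j))
    (A2_def : forall j, decomposes_as gam
       (prod_repr (gam j) (dual_repr (natural_repr Gam))) (fun i => A2 i j))
    (pi_irr : forall m n, SL3_irreducible (pi m n))
    (pi_hw : forall m n, has_highest_weight (pi m n) m n)
    (mult_def : forall m n,
       decomposes_as gam (restriction_repr Gam (pi m n)) (mult m n)) :
  let T := char_table gam g in
  let chi := fun x : Gam => \tr (natural_repr Gam x) in
  let MA1 := \matrix_(i, j) (A1 i j)%:R : 'M[F]_l.+1 in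
  let MA2 := \matrix_(i, j) (A2 i j)%:R : 'M[F]_l.+1 in
  let v := fun m n : nat => \col_i (mult m n i)%:R : 'cV[F]_l.+1 in
  let Delta := diag_mx (\row_j f_rat (chi (g j))^* (chi (g j))) in
  let TF := map_mx (@ratcst F) T in
  [/\ T \in unitmx,
      invmx T *m MA1 *m T = diag_mx (\row_j (chi (g j))^*),
      invmx T *m MA2 *m T = diag_mx (\row_j chi (g j))
    & forall i : 'I_l.+1,
        is_expansion
          ((TF *m Delta *m invmx TF *m map_mx (@ratcst F) (v 0%N 0%N)) i 0)
          (fun m n => v m n i 0)].
Proof.
move=> T chi MA1 MA2 v Delta TF.
have unitT : T \in unitmx := char_table_unit gam_irr g_classes.
have invT := char_table_inv gam_irr g_classes; rewrite -/T in invT.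
have trV x : \tr (natural_repr Gam x^-1%g) = (chi x)^*.
  by rewrite mxtrace_repr_inv ?inE.
split=> //.
- apply: (mult_matrix_conj gam_irr g_classes (c := fun k => chi (g k))) => j k.
  by rewrite -(mxtrace_decomposes_as _ (A1_def j)) mxtrace_prod.
- have -> : \row_j chi (g j) = \row_j ((chi (g j))^*)^*.
    by apply/rowP => j; rewrite !mxE conjCK.
  apply: (mult_matrix_conj gam_irr g_classes (c := fun k => (chi (g k))^*)) => j k.
  rewrite -(mxtrace_decomposes_as _ (A2_def j)) mxtrace_prod -trV.
  by rewrite /= mxtrace_tr.
pose w := class_weight g.
have rootg (x : Gam) : (0 < #[x]%g)%N /\ (val x : 'M_3) ^+ #[x]%g = 1.
  split; first exact: order_gt0.
  have := repr_mxX (natural_repr Gam) #[x]%g (in_setT x).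
  by rewrite expg_order repr_mx1 => <-.
(* Traces are taken at inverses because [char_table_conj] conjugates the character values. *)
pose s k m n := \tr (pi m n (val (g k)^-1%g)).
have vE m n : v m n = T *m (diag_mx (\row_j w j) *m \col_k s k m n).
  have -> : \col_k s k m n = map_mx Num.conj (\col_k \tr (pi m n (val (g k)))).
    apply/colP => k; rewrite !mxE /s.
    by rewrite (mxtrace_repr_inv (restriction_repr Gam (pi m n))) ?inE.
  apply: (char_table_conj gam_irr g_classes).
    by apply/matrixP => i j; rewrite !mxE rmorph_nat.
  apply/rowP => k; rewrite !mxE.
  rewrite (mxtrace_decomposes_as (g k) (mult_def m n)).
  by apply: eq_bigr => i _; rewrite !mxE.
have sE k : exists p q r : F, [/\ p * q * r = 1, (chi (g k))^* = p + q + r,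
    chi (g k) = p^-1 + q^-1 + r^-1
    & forall m n, s k m n = hsym p q r m * hsym p^-1 r^-1 q^-1 n
          - (if (m, n) is (m'.+1, n'.+1) then
               hsym p q r m' * hsym p^-1 r^-1 q^-1 n' else 0)].
  have [ord_gt0 gk1] := rootg (g k)^-1%g.
  have [p [q [r [pqr tr1 tr2 trpi]]]] := SL3_finite_order_trace ord_gt0 gk1.
  exists p, q, r; split=> // [||m n].
  - by rewrite -trV.
  - rewrite -tr2 -[invmx _]/(val ((g k)^-1^-1)%g : 'M_3).
    by rewrite invgK.
  - by apply: trpi.
(* In degree (0, 0) every s is 1, so T^-1 v_(0,0) is the vector of class weights, the same weights
   as in [vE]. *)
have v00 : v 0%N 0%N = T *m \col_k w k.
  rewrite vE; congr (_ *m _); apply/colP => k; rewrite mul_diag_mx !mxE.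
  have [p [q [r [_ _ _ ->]]]] := sE k.
  by rewrite /hsym !geom_conv0 !expr0 !mulr1 subr0 mulr1.
move=> i; have -> : (TF *m Delta *m invmx TF *m map_mx (@ratcst F) (v 0%N 0%N)) i 0 =
    \sum_k ratcst (T i k * w k) * f_rat (chi (g k))^* (chi (g k)).
  have unitTF : TF \in unitmx by rewrite /TF map_ratcst map_unitmx.
  rewrite v00 !map_ratcst map_mxM -!mulmxA mulKmx // mxE.
  apply: eq_bigr => k _; rewrite mul_diag_mx !mxE !ratcstE rmorphM.
  by rewrite [_ * ratcst_rmorphism F (w k)]mulrC mulrA.
have -> : (fun m n => v m n i 0) = fun m n => \sum_k (T i k * w k) * s k m n.
  apply/funext => m; apply/funext => n; rewrite vE mxE; apply: eq_bigr => k _.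
  by rewrite mul_diag_mx !mxE mulrA.
apply: is_expansion_sum => k; apply: is_expansionZ.
have [p [q [r [pqr chiE1 chiE2 skE]]]] := sE k.
have -> : s k = fun m n => hsym p q r m * hsym p^-1 r^-1 q^-1 n
    - (if (m, n) is (m'.+1, n'.+1) then
         hsym p q r m' * hsym p^-1 r^-1 q^-1 n' else 0).
  by apply/funext => m; apply/funext => n; apply: skE.
have [[nzp nzq] nzr] : (p != 0 /\ q != 0) /\ r != 0.
  by split; [split|]; apply: contra_eq_neq pqr => ->;
    rewrite ?(mul0r, mulr0) eq_sym oner_neq0.
(* As p q r = 1, the second elementary symmetric function of each triple is the sum of its inverses,
   which swaps d1 and d2. *)
apply: is_expansion_f_rat => //; rewrite ?chiE1 ?chiE2.
- rewrite -!invfM -[RHS]invr1 -[in RHS]pqr; congr (_^-1); ring.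
- rewrite -[LHS]mulr1 -[in LHS]pqr; field.
  by rewrite nzp nzq nzr.
- by ring.
- rewrite -[LHS]mulr1 -[X in _ * X]invr1 -[in X in _ * X]pqr; field.
  by rewrite nzp nzq nzr.
Qed.

Theorem mainTheorem2 (R : realType) (Gam : finSubgroupSL3 R[i]) (l : nat)
    (gam : 'I_l.+1 -> representation R[i] [set: Gam]%G)
    (g : 'I_l.+1 -> Gam)
    (A1 A2 : 'I_l.+1 -> 'I_l.+1 -> nat)
    (d : nat -> nat -> nat)
    (pi : forall m n : nat, SL3_representation R[i] (d m n))
    (mult : nat -> nat -> 'I_l.+1 -> nat)
    (gam_irr : irr_representatives gam)
    (gam0_triv : is_trivial_repr (gam ord0))
    (g_classes : class_representatives g)
    (A1_def : forall j, decomposes_as gam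
       (prod_repr (gam j) (natural_repr Gam)) (fun i => A1 i j))
    (A2_def : forall j, decomposes_as gam
       (prod_repr (gam j) (dual_repr (natural_repr Gam))) (fun i => A2 i j))
    (pi_irr : forall m n, SL3_irreducible (pi m n))
    (pi_hw : forall m n, has_highest_weight (pi m n) m n)
    (mult_def : forall m n,
       decomposes_as gam (restriction_repr Gam (pi m n)) (mult m n)) :
  let T := char_table gam g in
  let chi := fun x : Gam => \tr (natural_repr Gam x) in
  let MA1 := \matrix_(i, j) (A1 i j)%:R : 'M[R[i]]_l.+1 in
  let MA2 := \matrix_(i, j) (A2 i j)%:R : 'M[R[i]]_l.+1 in
  let v := fun m n : nat => \col_i (mult m n i)%:R : 'cV[R[i]]_l.+1 in
  let Delta := diag_mx (\row_j f_rat (chi (g j))^* (chi (g j))) in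
  let TF := map_mx (@ratcst R[i]) T in
  [/\ T \in unitmx,
      invmx T *m MA1 *m T = diag_mx (\row_j (chi (g j))^*),
      invmx T *m MA2 *m T = diag_mx (\row_j chi (g j))
    & forall i : 'I_l.+1,
        is_expansion
          ((TF *m Delta *m invmx TF *m map_mx (@ratcst R[i]) (v 0%N 0%N)) i 0)
          (fun m n => v m n i 0)].
Proof. exact: mckay_generating_function mult_def. Qed.
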